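(* Let $A,B\subseteq \mathbb{Z}$ be finite, nonempty subsets with $|B|\geq 3$, and let $s\geq 1$ be the unique integer with $$(s-1)s\left(\frac{|B|}{2}-1\right)+s-1<|A|\leq s(s+1)\left(\frac{|B|}{2}-1\right)+s.$$ Define the integer $r$ by $|A+B|=|A|+|B|+r$, and suppose $$|A+B|=|A|+|B|+r<\left(\frac{|A|}{s}+\frac{|B|}{2}-1\right)(s+1).$$ Then there exists an arithmetic progression $P_B\subseteq \mathbb{Z}$ such that $B\subseteq P_B$ and $|P_B|\leq |B|+r+1$.
   Context: For finite nonempty $A,B\subseteq\mathbb{Z}$, the sumset is $A+B=\{a+b: a\in A,\ b\in B\}$. *)

(* Defs.v *)
From mathcomp Require Import all_boot all_order all_algebra.
From mathcomp Require Import finmap.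
Set Implicit Arguments.
Unset Strict Implicit.
Unset Printing Implicit Defensive.

Import Order.TTheory GRing.Theory Num.Theory.
Local Open Scope fset_scope.
Local Open Scope ring_scope.

Definition sumset (A B : {fset int}) : {fset int} :=
  [fset a + b | a in A, b in B].

(* A finite arithmetic progression {a, a + d, ..., a + (n - 1) d}, n >= 1. *)
Definition is_arith_prog (P : {fset int}) : Prop :=
  exists (a d : int) (n : nat),
    [/\ 0 < d, (0 < n)%N & P = [fset a + d *+ i | i in iota 0 n]].

(* Main.v *)
(* Put D = |B| - 2, E(A) = |A + B| - |A|, and let n be the diameter of B divided
   by the gcd of its differences.  For every A, either n <= E(A), and then B lies
   in a progression with n + 1 <= E(A) + 1 = |B| + r + 1 terms, or
   |A + B| >= (|A|/t + |B|/2 - 1)(t + 1) for some t >= 1 (or A is empty).  The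
   hypotheses on |A| and s exclude the second case: they say that no t can do
   better than s, and the bound fails at s.

   The dichotomy is proved by induction on |A|.  After normalising min B = 0 and
   gcd B = 1, reduce modulo n = max B; every residue class met by A + B contains
   one element more of A + B than of A.  If |phi(A) + phi(B)| >= |phi(A)| + D in
   Z/n, removing the largest element of A in each class lowers E by at least D,
   and the bound for the smaller set at t gives the bound for A at t + 1.
   Otherwise Kneser's theorem yields a subgroup H, of order h, such that
   phi(A) + phi(B) is H-periodic and phi(A) nearly fills its H-cosets.  Then one
   counts elements of A over H-cosets and deletes from A all cosets outside a
   suitable set T together with the p largest elements of A over each coset in T;
   a counting argument over the level sets of the column heights controls the
   loss, and p is chosen so that the bound is inherited. *)

Require Import Defs.
From mathcomp Require Import all_boot all_order all_algebra.
From mathcomp Require Import finmap.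
From mathcomp Require Import zify ring lra.
Set Implicit Arguments.
Unset Strict Implicit.
Unset Printing Implicit Defensive.

Import Order.TTheory GRing.Theory Num.Theory.
Local Open Scope ring_scope.

(** * Arithmetic of a peeling step *)

(* Throughout, H has order h, phi(B) meets q + 1 cosets of H and D = q h + e; lam
   and w count the cosets of phi(A) that are kept and deleted, and Wt is the number
   of elements of A over the deleted ones. *)

Lemma mulr_pred_ge0 (x : int) : 0 <= x * (x - 1).
Proof. nia. Qed.

(** The case of the cut height [p = j * h]. With [E = (j + 1) * (q * h + e) - y] the conclusion is
    the bound of [attained] at [t = j] for the loss [lam * j * h + Wt] alone. The hypothesis on [Wt]
    is the conclusion of [heights_bound] at [c = w = q * j + x]. *)
Lemma wide_deletion (q h e lam j x y z Wt : int) :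
  1 <= q -> 1 <= e -> e < h -> 0 <= lam -> 1 <= j -> 1 <= x ->
  - (q - 1) <= y -> q <= z -> z = (j + 1) * e - (lam + x) * h - y ->
  2 * q * Wt <= 2 * (q * j + x) * z + 2 * (h - e) * (q * j + x) * q
                + (h - e) * (q * j + x) * (q * j + x - 1) ->
  2 * Wt + 2 * lam * j * h + j * (j + 1) * (q * h + e)
    <= 2 * j * ((j + 1) * (q * h + e) - y).
Proof.
move=> q1 e1 eh l0 j1 x1 y1 zq zE HW.
(* This is [q] times the goal once [Wt] and [z] are eliminated. The size of [h] is then controlled
   by [x * h <= (j + 1) * e - y - q], which is [q <= z] without its [lam] term. *)
suff: 0 <= - (h * (q * (q - 1) * j + x * (2 * q - 1 - x)))
  + e * (q * (q - 1) * j ^+ 2 + 2 * q * (q - 1) * j + 2 * j * x * (q - 1)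
         + 2 * q * x + x ^+ 2 - 3 * x) + 2 * x * y + 2 * x * lam * h.
  move=> H; rewrite -(@ler_pM2l _ q); last by lia.
  subst z; lia.
have hb : x * h <= (j + 1) * e - y - q by subst z; have := mulr_ge0 l0 (ltW (le_lt_trans (le_trans ler01 e1) eh)); lia.
have hb1 : h <= (j + 1) * e - y - q by apply: le_trans hb; rewrite ler_peMl //; lia.
have p1 : 0 <= q * (q - 1) * j by rewrite !mulr_ge0 //; lia.
have H1 : q * (q - 1) * j * h <= q * (q - 1) * j * ((j + 1) * e - y - q).
  by rewrite ler_wpM2l.
have p2 : 0 <= x * lam * h by rewrite !mulr_ge0 //; lia.
have p3 : 0 <= (e - 1) * (q * (q - 1) * j) by rewrite mulr_ge0 //; lia.
have p4 : 0 <= q * (q - 1) * j * (y + q - 1) by rewrite mulr_ge0 //; lia.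
have p5 : 0 <= (e - 1) * ((x - 1) * j * (2 * q - 1)) by rewrite !mulr_ge0 //; lia.
have p6 : 0 <= (j - 1) * ((x - 1) * (2 * q - 1)) by rewrite !mulr_ge0 //; lia.
have p7 : 0 <= e * (q * (x - 1)) by rewrite !mulr_ge0 //; lia.
have p8 : 0 <= e * (x - 1) ^+ 2 by rewrite !mulr_ge0 ?sqr_ge0 //; lia.
(* The sign of [2 * q - 1 - x] decides whether [x * h] has to be bounded above or contributes a
   nonnegative term. *)
have [hx|hx] := lerP x (2 * q - 1).
  have H2 : (2 * q - 1 - x) * (x * h) <= (2 * q - 1 - x) * ((j + 1) * e - y - q).
    by rewrite ler_wpM2l //; lia.
  have p9 : 0 <= (2 * q - 1 - x) * (y + q - 1) by rewrite mulr_ge0 //; lia.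
  have p10 : 0 <= x * (y + q - 1) by rewrite mulr_ge0 //; lia.
  lia.
have H2 : 0 <= (x - (2 * q - 1)) * (x * h) by rewrite !mulr_ge0 //; lia.
have p10 : 0 <= x * (y + q - 1) by rewrite mulr_ge0 //; lia.
have p11 : 0 <= (e - 1) * ((q - 1) * x) by rewrite !mulr_ge0 //; lia.
have p12 : 0 <= e * ((j - 1) * ((q - 1) * x)) by rewrite !mulr_ge0 //; lia.
have p13 : 0 <= e * (x * (x + 2 * q - 3)) by rewrite !mulr_ge0 //; lia.
lia.
Qed.

(** Here and in the next lemmas the conclusion is the slack left when a bound at [t = s - 1 - v] for
    the peeled set is turned into a bound at [s - 1]. A cut of height [p] removes [lam * p + Wt]
    elements and lowers [E = s * (q * h + e) - y] by [q * p + w * e]. Here [p = P + e], and [Wt] is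
    bounded through [c = q * a] with [a] the quotient of [p] by [h]. *)
Lemma short_low (q h e w s y z nu a f v P Wt lam : int) :
  2 <= q -> 1 <= e -> e < h -> 1 <= nu -> - (q - 1) <= y -> q <= z ->
  z = s * e - nu * h - y -> lam = (s - 1) * q + nu - w ->
  1 <= a -> 0 <= f -> f <= h - 1 -> P + e = a * h + f ->
  q * a + 1 <= w -> a + 2 <= s -> 0 <= v -> v <= a ->
  2 * Wt <= 2 * (w - q * a) * P + 2 * a * z + 2 * (h - e) * q * a
            + (h - e) * a * (q * a - 1) ->
  0 <= 2 * (s - 1) * (q * (P + e) + w * e) - 2 * (lam * (P + e) + Wt)
       - 2 * v * (q * (P + e) + w * e + y) + (q * h + e) * v * (v + 1).
Proof.
move=> q2 e1 eh nu1 y1 zq zE lE a1 f0 fh PE wa sa v0 va HW.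
have PE' : P = a * h + f - e by lia.
have nuh : nu * h <= s * e - y - q by lia.
have h1 : h <= nu * h by rewrite ler_peMl //; lia.
have t1 : 0 <= (h - 1 - f) * nu by rewrite mulr_ge0 //; lia.
have t2 : 0 <= (q - 1) * a * (s * e - h) by rewrite !mulr_ge0 //; lia.
have t3 : 0 <= e * ((s - a - 2) * (2 * w - 2 - (q + 1) * a)).
  have : 0 <= (q - 1) * a by rewrite mulr_ge0 //; lia.
  by move=> ?; rewrite !mulr_ge0 //; lia.
have t4 : 0 <= h * q * ((a - v) * (a - v - 1)).
  by rewrite mulr_ge0 ?mulr_pred_ge0 ?mulr_ge0 //; lia.
have t5 : 0 <= (a - v) * f * q by rewrite !mulr_ge0 //; lia.
have t6 : 0 <= (a - v) * (y + q - 1) by rewrite !mulr_ge0 //; lia.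
have t7 : 0 <= (e - 1) * ((a - v) * (w - a)).
  have : 0 <= (q - 1) * a by rewrite mulr_ge0 //; lia.
  by move=> ?; rewrite !mulr_ge0 //; lia.
have t8 : 0 <= (a - v) * ((q - 1) * (a - 1)) by rewrite !mulr_ge0 //; lia.
have t8' : 0 <= (a - v) * (w - q * a - 1) by rewrite !mulr_ge0 //; lia.
have t9 : 0 <= e * ((a - v) * (a - v - 1)).
  by rewrite mulr_ge0 ?mulr_pred_ge0 ?mulr_ge0 //; lia.
have t10 : 0 <= e * (w - q * a - 1) by rewrite !mulr_ge0 //; lia.
have t11 : 0 <= e * ((q - 2) * a) by rewrite !mulr_ge0 //; lia.
have t12 : 0 <= (w - a - 1) * (s * e).
  have : 0 <= (q - 1) * a by rewrite mulr_ge0 //; lia.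
  by move=> ?; rewrite !mulr_ge0 //; lia.
subst lam P z; lia.
Qed.

Lemma short_mid (q h e w s y z nu v P Wt lam : int) :
  1 <= q -> 1 <= e -> e < h -> 1 <= nu -> - (q - 1) <= y -> q <= z ->
  z = s * e - nu * h - y -> lam = (s - 1) * q + nu - w ->
  P + e <= v * h -> q * v <= w -> 0 <= v -> v <= s ->
  2 * Wt <= 2 * (w - q * v) * P + 2 * v * z + 2 * (h - e) * q * v
            + (h - e) * v * (q * v - 1) ->
  0 <= 2 * (s - 1) * (q * (P + e) + w * e) - 2 * (lam * (P + e) + Wt)
       - 2 * v * (q * (P + e) + w * e + y) + (q * h + e) * v * (v + 1).
Proof.
move=> q2 e1 eh nu1 y1 zq zE lE PE wv v0 vs HW.
have nuh : nu * h <= s * e - y - q by lia.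
have h1 : h <= nu * h by rewrite ler_peMl //; lia.
have t1 : 0 <= nu * (v * h - (P + e)) by rewrite mulr_ge0 //; lia.
have t2 : 0 <= (q - 1) * v * (s * e - h) by rewrite !mulr_ge0 //; lia.
have t3 : 0 <= e * ((s - v) * (2 * w - (q + 1) * v)).
  have : 0 <= (q - 1) * v by rewrite mulr_ge0 //; lia.
  by move=> ?; rewrite !mulr_ge0 //; lia.
subst lam z; lia.
Qed.

(** For [v = a + 1] the choice [c = q * v] may exceed [w], so [c = q * a] is kept and the upper
    bound on the drop [q * p + w * e] makes up for it. *)
Lemma short_top (q h e w s y z nu a mu p Wt lam : int) :
  2 <= q -> 1 <= e -> e < h -> 1 <= nu -> - (q - 1) <= y -> q <= z ->
  z = s * e - nu * h - y -> lam = (s - 1) * q + nu - w ->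
  0 <= a -> w = q * a + mu -> 1 <= mu -> a + 2 <= s ->
  p <= (a + 1) * h - 1 ->
  q * p + w * e <= (a + 1) * (q * h + e) - 1 ->
  2 * Wt <= 2 * (w - q * a) * (p - e) + 2 * a * z + 2 * (h - e) * q * a
            + (h - e) * a * (q * a - 1) ->
  0 <= 2 * (s - 1) * (q * p + w * e) - 2 * (lam * p + Wt)
       - 2 * (a + 1) * (q * p + w * e + y) + (q * h + e) * (a + 1) * (a + 2).
Proof.
move=> q2 e1 eh nu1 y1 zq zE lE a0 wE mu1 sa pa hp HW.
have nuh : nu * h <= s * e - y - q by lia.
have h1 : h <= nu * h by rewrite ler_peMl //; lia.
have t1 : 0 <= nu * ((a + 1) * h - 1 - p) by rewrite mulr_ge0 //; lia.
have t2 : 0 <= (q - 1) * a * (s * e - h) by rewrite !mulr_ge0 //; lia.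
have t3 : 0 <= e * ((s - a - 2) * ((q - 1) * a + 2 * (mu - 1))).
  have : 0 <= (q - 1) * a by rewrite mulr_ge0 //; lia.
  by move=> ?; rewrite !mulr_ge0 //; lia.
have t10 : 0 <= e * (mu - 1) by rewrite !mulr_ge0 //; lia.
have t11 : 0 <= e * ((q - 2) * a) by rewrite !mulr_ge0 //; lia.
subst lam z w; lia.
Qed.

(** The cut [p = (a + 1) * h - k] makes the drop [q * p + w * e] equal to
    [(a + 1) * (q * h + e) + r]. The bound on [Wt] is the one for [c = w]. *)
Lemma tall_top (q h e w s y z nu a mu k r Wt lam : int) :
  2 <= q -> 1 <= e -> e < h -> 1 <= nu -> - (q - 1) <= y -> q <= z ->
  z = s * e - nu * h - y -> lam = (s - 1) * q + nu - w ->
  0 <= a -> w = q * a + mu -> 1 <= mu -> mu <= q -> a + 2 <= s ->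
  0 <= k -> q * k = (w - (a + 1)) * e - r ->
  2 * q * Wt <= 2 * w * z + 2 * (h - e) * w * q + (h - e) * w * (w - 1) ->
  0 <= 2 * (s - 1) * (q * ((a + 1) * h - k) + w * e)
       - 2 * (lam * ((a + 1) * h - k) + Wt)
       - 2 * (a + 1) * (q * ((a + 1) * h - k) + w * e + y)
       + (q * h + e) * (a + 1) * (a + 2).
Proof.
move=> q2 e1 eh nu1 y1 zq zE lE a0 wE mu1 muq sa k0 kE HW.
rewrite -(@pmulr_rge0 _ q); last by lia.
have nuh : nu * h <= s * e - y - q by lia.
have h1 : h <= nu * h by rewrite ler_peMl //; lia.
have qa : 0 <= (q - 1) * a by rewrite mulr_ge0 //; lia.
have t0 : 0 <= q * k * (q - mu + nu) by rewrite !mulr_ge0 //; lia.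
have t2 : 0 <= (q * (q - 1) * a + mu * (mu - 1)) * (s * e - h).
  rewrite mulr_ge0 //; last by lia.
  by rewrite addr_ge0 ?mulr_pred_ge0 // -mulrA mulr_ge0 //; lia.
have t4 : 0 <= s * e * ((mu - 1) * (q - mu)) by rewrite !mulr_ge0 //; lia.
have t5 : 0 <= (q - mu) * z by rewrite !mulr_ge0 //; lia.
have t6 : 0 <= q * e * ((s - a - 2) * ((q - 1) * a + mu - 1)).
  by rewrite !mulr_ge0 //; lia.
have t7 : 0 <= e * ((q * a + mu) * (mu - 1)).
  by rewrite !mulr_ge0 //; lia.
subst lam z w; lia.
Qed.

(** The cut is [P + e]. The range of [v] is divided at the quotient of [P + e] by [h] and at [j].
    Above [j] the slack, a convex quadratic in [v], only grows because the drop stays below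
    [j * (q * h + e)]. *)
Lemma short_peel (q h e lam w s P Wt y z nu j v : int) :
  2 <= q -> 1 <= e -> e < h -> 1 <= nu -> - (q - 1) <= y ->
  y <= q * h + e - q -> q <= z -> z = s * e - nu * h - y ->
  lam = (s - 1) * q + nu - w -> h + 1 <= P + e ->
  (forall c : int, 0 <= c -> c <= w ->
    2 * q * Wt <= 2 * q * (w - c) * P + 2 * c * z
      + 2 * (h - e) * c * q + (h - e) * c * (c - 1)) ->
  P + e <= j * h - 1 -> 1 <= j -> j + 1 <= s -> q * (j - 1) + 1 <= w ->
  0 <= v -> v <= s - 1 ->
  (j = s - 1 /\ q * j <= w \/
   w <= q * j /\ q * (P + e) + w * e <= j * (q * h + e) - 1) ->
  0 <= 2 * (s - 1) * (q * (P + e) + w * e) - 2 * (lam * (P + e) + Wt)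
       - 2 * v * (q * (P + e) + w * e + y) + (q * h + e) * v * (v + 1).
Proof.
move=> q2 e1 eh nu1 y1 y2 zq zE lE hP HR pj j1 js wj v0 vs Hj.
have HR' c : 0 <= c -> q * c <= w ->
    2 * Wt <= 2 * (w - q * c) * P + 2 * c * z
      + 2 * (h - e) * q * c + (h - e) * c * (q * c - 1).
  move=> c0 cw; have qc0 : 0 <= q * c by rewrite mulr_ge0; lia.
  by have := HR _ qc0 cw => H; rewrite -(@ler_pM2l _ q); lia.
pose a := ((P + e) %/ h)%Z; pose f := ((P + e) %% h)%Z.
have PaE : P + e = a * h + f by apply: divz_eq.
have f0 : 0 <= f by apply: modz_ge0; lia.
have fh : f < h by apply: ltz_pmod; lia.
have a1 : 1 <= a.
  rewrite leNgt; apply/negP => a0.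
  have : a * h <= 0 by rewrite mulr_le0_ge0; lia.
  lia.
have aj : a <= j - 1.
  rewrite leNgt; apply/negP => ja.
  have : 0 <= (a - j) * h by rewrite mulr_ge0; lia.
  lia.
have qaj : q * a <= q * (j - 1) by rewrite ler_wpM2l //; lia.
have [va|va] := leP v a.
  by apply: (@short_low q h e w s y z nu a f v P Wt lam); try lia; apply: HR'; lia.
have vh : P + e <= v * h.
  have : 0 <= (v - (a + 1)) * h by rewrite mulr_ge0; lia.
  lia.
have [vj|vj] := leP v (j - 1).
  have qvj : q * v <= q * (j - 1) by rewrite ler_wpM2l //; lia.
  by apply: (@short_mid q h e w s y z nu v P Wt lam); try lia; apply: HR'; lia.
case: Hj => [[jE qjw]|[wqj hp]].
  have vjE : v = j by lia.
  apply: (@short_mid q h e w s y z nu v P Wt lam); try lia.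
  by apply: HR'; rewrite ?vjE; lia.
have Htop : 0 <= 2 * (s - 1) * (q * (P + e) + w * e) - 2 * (lam * (P + e) + Wt)
       - 2 * (j - 1 + 1) * (q * (P + e) + w * e + y)
       + (q * h + e) * (j - 1 + 1) * (j - 1 + 2).
  apply: (@short_top q h e w s y z nu (j - 1) (w - q * (j - 1))); rewrite ?subrK; try lia.
  by have := HR' (j - 1); rewrite addrK; lia.
have t1 : 0 <= (v - j) * (q * h + e - q - y) by rewrite mulr_ge0; lia.
have t2 : 0 <= (v - j) * (j * (q * h + e) - 1 - (q * (P + e) + w * e)).
  by rewrite mulr_ge0; lia.
have t3 : 0 <= (v - j) * (v - j - 1) * (q * h + e).
  rewrite mulr_ge0 ?mulr_pred_ge0 //.
  have : 0 <= q * h by rewrite mulr_ge0; lia.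
  lia.
have t4 : 0 <= (v - j) * q by rewrite mulr_ge0; lia.
lia.
Qed.

(** The drop equals [j * (q * h + e) + r], so the slack at any [v] can be compared with its value at
    [v = j]. If [y < 0] this comparison may fail below [j]; the second alternative then aims at the
    bound for [s] instead of [s - 1], which gains [- 2 * y]. *)
Lemma tall_peel (q h e lam w s Wt y z nu j k r v : int) :
  2 <= q -> 1 <= e -> e < h -> 1 <= nu -> - (q - 1) <= y ->
  y <= q * h + e - q -> q <= z -> z = s * e - nu * h - y ->
  lam = (s - 1) * q + nu - w ->
  2 * q * Wt <= 2 * w * z + 2 * (h - e) * w * q + (h - e) * w * (w - 1) ->
  1 <= j -> j + 1 <= s -> q * (j - 1) + 1 <= w -> w <= q * j ->
  0 <= k -> q * k = (w - j) * e - r -> 0 <= r -> r <= q - 1 ->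
  (0 <= 2 * (s - 1) * (q * (j * h - k) + w * e) - 2 * (lam * (j * h - k) + Wt)
       - 2 * v * (q * (j * h - k) + w * e + y) + (q * h + e) * v * (v + 1)) \/
  (y <= 0 /\
   0 <= 2 * (s - 1) * (q * (j * h - k) + w * e) - 2 * (lam * (j * h - k) + Wt)
       - 2 * v * (q * (j * h - k) + w * e + y) + (q * h + e) * v * (v + 1)
       - 2 * y).
Proof.
move=> q2 e1 eh nu1 y1 y2 zq zE lE HW j1 js wj wqj k0 kE r0 rq.
have Htop : 0 <= 2 * (s - 1) * (q * ((j - 1 + 1) * h - k) + w * e)
       - 2 * (lam * ((j - 1 + 1) * h - k) + Wt)
       - 2 * (j - 1 + 1) * (q * ((j - 1 + 1) * h - k) + w * e + y)
       + (q * h + e) * (j - 1 + 1) * (j - 1 + 2).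
  by apply: (@tall_top q h e w s y z nu (j - 1) (w - q * (j - 1)) k r Wt lam); rewrite ?subrK; lia.
have qh : q * 2 <= q * h by rewrite ler_wpM2l; lia.
have [vj|vj] := leP j v.
  left.
  have t1 : 0 <= (v - j) * (q * h + e - y - r) by rewrite mulr_ge0; lia.
  have t3 : 0 <= (v - j) * (v - j - 1) * (q * h + e).
    by rewrite mulr_ge0 ?mulr_pred_ge0 //; lia.
  lia.
have t3 : 0 <= (j - v) * (j - v - 1) * (q * h + e).
  by rewrite mulr_ge0 ?mulr_pred_ge0 //; lia.
have [y0|y0] := leP 0 y.
  left; have : 0 <= (j - v) * (r + y) by rewrite mulr_ge0; lia.
  lia.
right; split; first by lia.
have t4 : 0 <= (j - v - 1) * ((j - v) * (q * h + e) + 2 * (r + y)).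
  rewrite mulr_ge0 //; first by lia.
  have : q * h + e <= (j - v) * (q * h + e) by rewrite ler_peMl; lia.
  lia.
have t5 : 0 <= (j - v) * r by rewrite mulr_ge0; lia.
lia.
Qed.

(* For t > 0 the inequality reads (a/t + D/2)(t + 1) <= a + E; t = 0 allows only a = 0. *)
Definition attained (D a E : nat) :=
  exists t : nat, (2 * a + t * t.+1 * D <= 2 * t * E)%N.

(** A bound at [t1 <= s - 1] becomes one at [s - 1] or, in the second alternative, at [s]. A bound
    at [t1 >= s] keeps its [t1]: the case [v = 0] gives [cost <= t1 * dr], where the second
    alternative uses [- y <= dr]. *)
Lemma combine_peel (D E s y dr cost a1 t1 : int) :
  0 <= a1 -> 0 <= t1 -> 1 <= s -> E = s * D - y -> 0 <= dr -> - y <= dr ->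
  2 * a1 + t1 * (t1 + 1) * D <= 2 * t1 * (E - dr) ->
  (forall v, 0 <= v -> v <= s - 1 ->
     0 <= 2 * (s - 1) * dr - 2 * cost - 2 * v * (dr + y) + D * v * (v + 1) \/
     y <= 0 /\
     0 <= 2 * (s - 1) * dr - 2 * cost - 2 * v * (dr + y) + D * v * (v + 1) - 2 * y) ->
  exists2 t, 0 <= t & 2 * (a1 + cost) + t * (t + 1) * D <= 2 * t * E.
Proof.
move=> a0 t0 s1 EE dr0 ydr H1 HQ; subst E.
have [ts|ts] := leP t1 (s - 1).
  have [] := HQ (s - 1 - t1); try lia.
    by exists (s - 1); lia.
  by case=> y0 H; exists s; lia.
have := HQ 0; rewrite lexx subr_ge0 s1 => /(_ isT isT) H.
exists t1 => //.
have : 0 <= (t1 - s) * dr by rewrite mulr_ge0; lia.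
by case: H => [H|[_ H]]; lia.
Qed.

(** Choice of the number [p] of elements cut over each kept coset; [P + e] is the largest cut
    allowed when some coset is kept. Let [s0] be the quotient of [E - q] by [D]. If [w > q * s0],
    the cut is [s0 * h], or [P + e] if that is smaller. Otherwise it is [j * h - k], or [P + e] if
    that is smaller, with [j] the ceiling of [w / q]. *)
Lemma peel_choice (q h e lam w P Wt E : nat) :
  (0 < q)%N -> (0 < e < h)%N -> (0 < w)%N -> (h < P + e)%N ->
  (lam = 0%N \/ (1 < q)%N) -> ((lam + w + q) * h + q <= E)%N ->
  (forall s : nat, (s * (q * h + e) + q <= E)%N -> (s * q < lam + w)%N) ->
  (forall c : nat, (c <= w)%N ->
    (2 * q * Wt <= 2 * q * (w - c) * P + 2 * c * (E - (lam + w + q) * h)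
      + 2 * (h - e) * c * q + (h - e) * (c * c.-1))%N) ->
  exists p : nat,
    (lam = 0%N \/ (p <= P + e)%N) /\
    forall a1 E1 : nat, (lam = 0%N -> a1 = 0%N) ->
      (lam = 0%N \/ (E1 + (p * q + w * e) <= E)%N) ->
      attained (q * h + e) a1 E1 -> attained (q * h + e) (a1 + p * lam + Wt) E.
Proof.
move=> q0 /andP[e0 eh] w0 hP Hq Hz Hflat HR.
set D := (q * h + e)%N.
pose s0 := ((E - q) %/ D)%N.
have D0 : (0 < D)%N by rewrite /D; lia.
have s0E := divn_eq (E - q) D; rewrite -/s0 in s0E.
have s0lt : ((E - q) %% D < D)%N by rewrite ltn_mod.
have Dl : (D <= E - q)%N.
  have : (1 * h <= (lam + w) * h)%N by rewrite leq_mul2r; lia.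
  by rewrite /D; lia.
have s01 : (0 < s0)%N by rewrite divn_gt0.
have flat : (s0 * q < lam + w)%N by apply: Hflat; lia.
(* The shift by [q] in the definition of [s0] places [y] between [1 - q] and [D - q]. *)
pose s : int := s0%:Z + 1; pose y : int := s * D%:Z - E%:Z.
pose nu : int := (lam + w)%N%:Z - s0%:Z * q%:Z.
pose z : int := E%:Z - ((lam + w + q) * h)%N%:Z.
have nu1 : 1 <= nu by rewrite /nu; lia.
have y1 : - (q%:Z - 1) <= y by rewrite /y /s; lia.
have y2 : y <= q%:Z * h%:Z + e%:Z - q%:Z by rewrite /y /s /D; lia.
have zq : q%:Z <= z by rewrite /z; lia.
have zE : z = s * e%:Z - nu * h%:Z - y by rewrite /z /y /nu /s /D; lia.
have lE : lam%:Z = (s - 1) * q%:Z + nu - w%:Z by rewrite /nu /s; lia.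
have EE : E%:Z = s * D%:Z - y by rewrite /y; lia.
have HR' (c : int) : 0 <= c -> c <= w%:Z ->
    2 * q%:Z * Wt%:Z <= 2 * q%:Z * (w%:Z - c) * P%:Z + 2 * c * z
      + 2 * (h%:Z - e%:Z) * c * q%:Z + (h%:Z - e%:Z) * c * (c - 1).
  move=> c0 cw; have [n cE] : exists n : nat, c = n%:Z by exists `|c|%N; lia.
  have nw : (n <= w)%N by lia.
  have := HR n nw; rewrite cE /z; move: Hz eh nw; clear.
  move=> Hz eh nw.
  have [E' EE'] : exists E', E = ((lam + w + q) * h + E')%N.
    by exists (E - (lam + w + q) * h)%N; lia.
  have [h' hE'] : exists h', h = (e + h')%N by exists (h - e)%N; lia.
  have [w' wE'] : exists w', w = (n + w')%N by exists (w - n)%N; lia.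
  have -> : (E - (lam + w + q) * h = E')%N by lia.
  have -> : E%:Z - ((lam + w + q) * h)%N%:Z = E'%:Z by lia.
  have -> : (h - e = h')%N by lia.
  have -> : h%:Z - e%:Z = h'%:Z by lia.
  have -> : (w - n = w')%N by lia.
  have -> : w%:Z - n%:Z = w'%:Z by lia.
  clear; case: n => [|n] /=; lia.
clearbody y nu z.
have finish p : (lam = 0%N \/ (p <= P + e)%N) ->
    (forall v : int, 0 <= v -> v <= s - 1 ->
     0 <= 2 * (s - 1) * (q%:Z * p%:Z + w%:Z * e%:Z) - 2 * (lam%:Z * p%:Z + Wt%:Z)
       - 2 * v * (q%:Z * p%:Z + w%:Z * e%:Z + y) + D%:Z * v * (v + 1) \/
     y <= 0 /\
     0 <= 2 * (s - 1) * (q%:Z * p%:Z + w%:Z * e%:Z) - 2 * (lam%:Z * p%:Z + Wt%:Z)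
       - 2 * v * (q%:Z * p%:Z + w%:Z * e%:Z + y) + D%:Z * v * (v + 1) - 2 * y) ->
    (0 < lam)%N -> (0 < p)%N -> 
    exists p : nat,
    (lam = 0%N \/ (p <= P + e)%N) /\
    forall a1 E1 : nat, (lam = 0%N -> a1 = 0%N) ->
      (lam = 0%N \/ (E1 + (p * q + w * e) <= E)%N) ->
      attained D a1 E1 -> attained D (a1 + p * lam + Wt) E.
  move=> Hp HQ l0 p0; exists p; split=> // a1 E1 _ [|HE]; first by lia.
  move=> [t1 Ht1].
  have HE' : 2 * t1%:Z * E1%:Z <= 2 * t1%:Z * (E%:Z - (q%:Z * p%:Z + w%:Z * e%:Z)).
    by rewrite ler_wpM2l; lia.
  have pq : (q <= p * q)%N by rewrite leq_pmull.
  have [] := @combine_peel D E s y (q%:Z * p%:Z + w%:Z * e%:Z)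
    (lam%:Z * p%:Z + Wt%:Z) a1 t1 _ _ _ EE _ _ _ HQ; rewrite /s; try lia.
  by move=> t t0 Ht; exists `|t|%N; lia.
have [ws|ws] := ltnP (q * s0) w.
  have [lh|lh] : (lam = 0%N \/ (s0 * h <= P + e)%N) \/ (0 < lam)%N /\ (P + e < s0 * h)%N.
    have [|] := leqP (s0 * h) (P + e); first by auto.
    by case: (lam); auto.
    have nuE : nu = lam%:Z + (w%:Z - q%:Z * s0%:Z) by rewrite lE /s; lia.
    have zE' : z = (s0%:Z + 1) * e%:Z - (lam%:Z + (w%:Z - q%:Z * s0%:Z)) * h%:Z - y.
      by rewrite -nuE.
    have Hw := HR' w (le0z_nat w) (lexx _).
    have Hb : 2 * Wt%:Z + 2 * lam%:Z * s0%:Z * h%:Z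
        + s0%:Z * (s0%:Z + 1) * (q%:Z * h%:Z + e%:Z)
      <= 2 * s0%:Z * ((s0%:Z + 1) * (q%:Z * h%:Z + e%:Z) - y).
      by apply: (@wide_deletion q h e lam s0 (w%:Z - q%:Z * s0%:Z) y z Wt) => //; lia.
    exists (s0 * h)%N; split=> // a1 E1 Ha HE [t1 Ht1].
    have wj : (s0 * e <= w * e)%N.
      have : (s0 <= q * s0)%N by rewrite leq_pmull.
      by rewrite leq_mul2r; lia.
    have Hb' : (2 * Wt + 2 * lam * s0 * h + s0 * s0.+1 * D <= 2 * s0 * E)%N.
      by rewrite /D; move: Hb EE; rewrite /s /D; lia.
    case: HE => [l0|HE].
      by exists s0; rewrite (Ha l0) l0; move: Hb'; rewrite l0; lia.
    (* The bound at [t1] for the peeled set and the bound at [s0] for the loss add up at [t1 + s0]: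
       the drop of at least [s0 * D] pays for the cross term [2 * t1 * s0 * D]. *)
    exists (t1 + s0)%N.
    have : (2 * t1 * (E1 + (s0 * h * q + w * e)) <= 2 * t1 * E)%N by rewrite leq_mul2l HE orbT.
    have : (t1 * (s0 * e) <= t1 * (w * e))%N by rewrite leq_mul2l wj orbT.
    by move: Ht1 Hb'; rewrite /D; lia.
  case: lh => l0 lh.
  apply: (finish (P + e)%N) => //; try lia.
  move=> v v0 vs; left; rewrite PoszD /D PoszD PoszM.
  by apply: (@short_peel q h e lam w s P Wt y z nu s0) => //; rewrite ?/s; lia.
have l0 : (0 < lam)%N by lia.
have q2 : (1 < q)%N by case: Hq => //; lia.
pose j := ((w + q - 1) %/ q)%N.
have jE := divn_eq (w + q - 1) q; rewrite -/j in jE.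
have jm : ((w + q - 1) %% q < q)%N by rewrite ltn_mod.
have j1 : (0 < j)%N by rewrite divn_gt0; lia.
have wjlo : q%:Z * (j%:Z - 1) + 1 <= w%:Z by lia.
have wjhi : w%:Z <= q%:Z * j%:Z by lia.
have js : (j <= s0)%N.
  rewrite -ltnS ltn_divLR //; lia.
have qj : (q * (j - 1) = q * j - q)%N by rewrite mulnBr muln1.
have qj' : (q <= q * j)%N by rewrite leq_pmulr.
have wj : (j <= w)%N.
  have : (1 * (j - 1) <= q * (j - 1))%N by rewrite leq_mul2r; lia.
  by lia.
(* The largest [k] for which the cut [j * h - k] still lowers [E] by [j * D]; the drop is then
   [j * D + r]. *)
pose k := ((w - j) * e %/ q)%N; pose r := ((w - j) * e %% q)%N.
have kE : ((w - j) * e = k * q + r)%N by apply: divn_eq.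
have rq : (r < q)%N by rewrite ltn_mod.
have kjh : (k < j * h)%N.
  rewrite ltn_divLR //.
  apply: (@leq_ltn_trans (q * j * e)); first by rewrite leq_mul2r; lia.
  by rewrite -mulnA mulnC ltn_mul2r q0 ltn_mul2l j1.
have kEZ : q%:Z * k%:Z = (w%:Z - j%:Z) * e%:Z - r%:Z.
  by rewrite subzn // -[(w - j)%N%:Z * _]PoszM kE; lia.
have Hw := HR' w (le0z_nat w) (lexx _).
rewrite subrr mulr0 mul0r add0r in Hw.
have jsZ : j%:Z + 1 <= s by rewrite /s; lia.
have sE : s0%:Z + 1 = s by [].
clearbody k r j; clear kE jE jm qj qj' wj js Hz Hflat ws flat.
have [ph|ph] := leqP (j * h) (P + e + k).
  apply: (finish (j * h - k)%N) => //; try lia.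
  move=> v v0 vs; rewrite -subzn 1?ltnW // PoszM /D PoszD PoszM.
  by apply: (@tall_peel q h e lam w s Wt y z nu j k r v) => //; lia.
have hp : q%:Z * (P%:Z + e%:Z) + w%:Z * e%:Z <= j%:Z * (q%:Z * h%:Z + e%:Z) - 1.
  have : (q * (P + e + k).+1 <= q * (j * h))%N by rewrite leq_mul2l ph orbT.
  by move: kEZ rq; clear; lia.
have ph' : P%:Z + e%:Z <= j%:Z * h%:Z - 1 by lia.
apply: (finish (P + e)%N) => //; [by right|move=> v v0 vs; left|by lia].
rewrite PoszD /D PoszD PoszM.
apply: (@short_peel q h e lam w s P Wt y z nu j) => //; lia.
Qed.

(** * Kneser's theorem *)

Section Kneser.
Variable G : finZmodType.
Implicit Types (A B C S H : {set G}) (a b g x y : G).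

Definition sums A B : {set G} := [set a + b | a in A, b in B].

Definition stab C : {set G} := [set g | [forall x, (x + g \in C) == (x \in C)]].

Lemma sumsP A B x :
  reflect (exists2 a, a \in A & x - a \in B) (x \in sums A B).
Proof.
apply: (iffP imset2P) => [[a b aA bB ->]|[a aA bB]].
  by exists a => //; rewrite addrC addKr.
by exists a (x - a) => //; rewrite addrC subrK.
Qed.

Lemma mem_sums A B a b : a \in A -> b \in B -> a + b \in sums A B.
Proof. by move=> aA bB; apply/imset2P; exists a b. Qed.

Lemma sumsSl A A' B : A \subset A' -> sums A B \subset sums A' B.
Proof. by move=> /subsetP sA; apply/subsetP => x /sumsP[a /sA aA bB]; apply/sumsP; exists a. Qed.

Lemma stabP C g : reflect (forall x, (x + g \in C) = (x \in C)) (g \in stab C).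
Proof.
rewrite inE; apply: (iffP forallP) => H x; first exact/eqP.
by rewrite H.
Qed.

Lemma stab0 C : 0 \in stab C.
Proof. by apply/stabP => x; rewrite addr0. Qed.

Lemma stabB C g g' : g \in stab C -> g' \in stab C -> g - g' \in stab C.
Proof.
move=> /stabP gC /stabP gC'; apply/stabP => x.
by rewrite -(gC' (x + (g - g'))) addrA subrK gC.
Qed.

Lemma stabD C g g' : g \in stab C -> g' \in stab C -> g + g' \in stab C.
Proof.
move=> /stabP gC /stabP gC'; apply/stabP => x.
by rewrite addrA gC' gC.
Qed.

Lemma stabI C1 C2 : stab C1 :&: stab C2 \subset stab (C1 :|: C2).
Proof.
apply/subsetP => g /setIP[/stabP g1 /stabP g2]; apply/stabP => x.
by rewrite !inE g1 g2.
Qed.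

(* The hypothesis bounds the number of representations of an element of P + Q by #|F|. *)
Lemma card_sums_fiber (F P Q : {set G}) :
  (forall x x' y y', x \in P -> x' \in P -> y \in Q -> y' \in Q ->
     x + y = x' + y' -> x - x' \in F) ->
  (#|P| * #|Q| <= #|F| * #|sums P Q|)%N.
Proof.
move=> HF; rewrite -cardsX -(sum1_card (mem (setX P Q))).
rewrite (partition_big (fun u => u.1 + u.2) (mem (sums P Q))) /=; last first.
  by case=> x y; rewrite inE /= => /andP[xP yQ]; apply: mem_sums.
rewrite mulnC -sum_nat_const; apply: leq_sum => z /imset2P[x0 y0 x0P y0Q zE].
rewrite sum1dep_card.
rewrite -(card_in_imset (f := fun u : G * G => u.1 - x0)).
  apply: subset_leq_card; apply/subsetP => _ /imsetP[[x y] + ->].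
  rewrite !inE /= => /andP[/andP[xP yQ] /eqP xyz].
  by apply: (HF _ _ y y0) => //; rewrite xyz.
move=> [x y] [x' y']; rewrite !inE /=.
move=> /andP[/andP[xP yQ] /eqP xyz] /andP[/andP[xP' yQ'] /eqP xyz'] /addIr xx'.
congr (_, _) => //; move: xyz; rewrite xx' -xyz' => /addrI //.
Qed.

Lemma card_translate_sub (F P : {set G}) x0 :
  (forall f, f \in F -> x0 + f \in P) -> (#|F| <= #|P|)%N.
Proof.
move=> H; rewrite -(card_imset (mem F) (addrI x0)); apply: subset_leq_card.
by apply/subsetP => _ /imsetP[f fF ->]; apply: H.
Qed.

(** At [c + x + y] with [x] in [stab C2] and [y] in [stab C1], membership in [C1] depends on [x]
    only and membership in [C2] on [y] only. So [c + P + S] lies in [C2 :\: C1], and the complements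
    of [P] and [S] give a sum inside [C1 :\: C2]; [card_sums_fiber] bounds both sizes from below by
    products. *)
Lemma stab_union_step C1 C2 c : c \in C2 -> c \notin C1 ->
  let f := #|stab C1 :&: stab C2| in
  [\/ (#|stab C1| <= #|C2 :\: C1| + f)%N, (#|stab C2| <= #|C1 :\: C2| + f)%N
    | (#|stab C2| <= #|C2 :\: C1|)%N].
Proof.
move=> cC2 cC1; set H1 := stab C1; set H2 := stab C2; set F := H1 :&: H2 => f.
pose P := [set x in H2 | c + x \notin C1]; pose S := [set y in H1 | c + y \in C2].
have f0 : (0 < f)%N by apply/card_gt0P; exists 0; rewrite inE !stab0.
have sPH : P \subset H2 by apply/subsetP => x; rewrite inE => /andP[].
have sSH : S \subset H1 by apply/subsetP => x; rewrite inE => /andP[].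
have fP : (f <= #|P|)%N.
  apply: (@card_translate_sub _ _ 0) => x /setIP[x1 x2]; rewrite add0r inE x2.
  by move/stabP: x1 => ->.
have fS : (f <= #|S|)%N.
  apply: (@card_translate_sub _ _ 0) => x /setIP[x1 x2]; rewrite add0r inE x1.
  by move/stabP: x2 => ->.
have inF x x' y y' : x \in H2 -> x' \in H2 -> y \in H1 -> y' \in H1 ->
    x + y = x' + y' -> x - x' \in F.
  move=> x2 x2' y1 y1' E; apply/setIP; split; last exact: stabB.
  suff -> : x - x' = y' - y by apply: stabB.
  by apply/eqP; rewrite subr_eq addrAC eq_sym subr_eq E addrC.
have E1 : (#|P| * #|S| <= f * #|C2 :\: C1|)%N.
  apply: leq_trans (@card_sums_fiber F P S _) _.
    by move=> x x' y y' /(subsetP sPH) ? /(subsetP sPH) ? /(subsetP sSH) ? /(subsetP sSH) ?; apply: inF.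
  rewrite leq_mul2l; apply/orP; right.
  apply: (@card_translate_sub _ _ c) => _ /imset2P[x y /setIdP[x2 xC1] /setIdP[y1 yC2] ->].
  rewrite in_setD; have Hx := stabP _ _ x2; have Hy := stabP _ _ y1.
  by rewrite addrA Hy xC1 addrAC Hx yC2.
have E2 : (#|H2 :\: P| * #|H1 :\: S| <= f * #|C1 :\: C2|)%N.
  apply: leq_trans (@card_sums_fiber F (H2 :\: P) (H1 :\: S) _) _.
    by move=> x x' y y' /setDP[? _] /setDP[? _] /setDP[? _] /setDP[? _]; apply: inF.
  rewrite leq_mul2l; apply/orP; right.
  apply: (@card_translate_sub _ _ c) => _ /imset2P[x y /setDP[x2 xP] /setDP[y1 yS] ->].
  have xC1 : c + x \in C1 by move: xP; rewrite in_set x2 negbK.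
  have yC2 : c + y \notin C2 by move: yS; rewrite in_set y1.
  rewrite in_setD.
  have Hx := stabP _ _ x2; have Hy := stabP _ _ y1.
  by rewrite addrA Hy xC1 addrAC Hx yC2.
have cP : (#|H2 :\: P| = #|H2| - #|P|)%N by rewrite cardsD (setIidPr sPH).
have cS : (#|H1 :\: S| = #|H1| - #|S|)%N by rewrite cardsD (setIidPr sSH).
have lP := subset_leq_card sPH; have lS := subset_leq_card sSH.
have [P0|/set0Pn[x0]] := eqVneq (H2 :\: P) set0.
  apply: Or33; move: cP; rewrite P0 cards0 => cP.
  have {}cP : #|P| = #|H2| by lia.
  rewrite -(@leq_pmul2l f) //; apply: leq_trans E1; rewrite cP mulnC leq_mul2l fS orbT //.
case/setDP=> x02 x0P.
have fP' : (f <= #|H2 :\: P|)%N.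
  apply: (@card_translate_sub _ _ x0) => x /setIP[x1 x2].
  have xx : x0 + x \in H2 by apply: stabD.
  have xC1 : c + x0 \in C1 by move: x0P; rewrite in_set x02 negbK.
  by rewrite in_setD in_set xx addrA (stabP _ _ x1) xC1.
have [|C2C1] := leqP #|H1| (#|C2 :\: C1| + f); first by move=> ?; apply: Or31.
apply: Or32.
have : (f * #|C2 :\: C1| < f * (#|H1| - f))%N by rewrite ltn_pmul2l //; lia.
move: E1 E2; rewrite cP cS; rewrite cP in fP'.
move: (#|P|) (#|S|) (#|H1|) (#|H2|) (#|C2 :\: C1|) (#|C1 :\: C2|) fP fS lP lS fP' f0 => p s m1 m2 u v.
move=> fp fs pm sm fpm f0 E1 E2 E3.
rewrite -(@leq_pmul2l f) //.
have [p' pE] : exists p', p = (f + p')%N by exists (p - f)%N; lia.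
have [s' sE] : exists s', s = (f + s')%N by exists (s - f)%N; lia.
have [t tE] : exists t, m2 = (p + f + t)%N by exists (m2 - p - f)%N; lia.
(* Two numbers that are at least [f] have product at least [f] times their sum minus [f]. For [p]
   and [s] this forces the claim; for [m2 - p] and [p] it then yields the goal. *)
have k2 : (p <= m1 - s)%N.
  rewrite leqNgt; apply/negP => k2.
  have : (f * (m1 - f) <= f * (f + p' + s'))%N by rewrite leq_mul2l; lia.
  by subst p s; lia.
have : ((m2 - p) * p <= (m2 - p) * (m1 - s))%N by rewrite leq_mul2l k2 orbT.
have -> : (m2 - p = f + t)%N by lia.
by move: E2; rewrite (_ : m2 - p = f + t)%N; [subst p m2; lia|lia].
Qed.

Lemma stab_union_arith (c1 c2 u d12 d21 m1 m2 f m : nat) :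
  u = (c1 + d21)%N -> u = (c2 + d12)%N -> (f <= m)%N ->
  [\/ (m2 <= d12 + f)%N, (m1 <= d21 + f)%N | (m1 <= d12)%N] ->
  [\/ (m1 <= d21 + f)%N, (m2 <= d12 + f)%N | (m2 <= d21)%N] ->
  (c1 + m1 <= u + m)%N \/ (c2 + m2 <= u + m)%N.
Proof.
move=> U1 U2 fm [] H1 [] H2; try by [left; lia | right; lia].
by have [m12|m12] := leqP m1 m2; [left|right]; lia.
Qed.

(** Taking unions never brings size plus stabiliser size below the smaller of the two values.
    [stab_union_step] is used in both orders; when both give their third alternative, the set with
    the smaller stabiliser satisfies the bound. *)
Lemma stab_setU C1 C2 :
  (#|C1| + #|stab C1| <= #|C1 :|: C2| + #|stab (C1 :|: C2)|)%N \/
  (#|C2| + #|stab C2| <= #|C1 :|: C2| + #|stab (C1 :|: C2)|)%N.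
Proof.
have [s12|/subsetPn[c cC1 cC2]] := boolP (C1 \subset C2).
  by right; move/setUidPr: s12 => ->.
have [s21|/subsetPn[c' cC2' cC1']] := boolP (C2 \subset C1).
  by left; move/setUidPl: s21 => ->.
have fU := subset_leq_card (stabI C1 C2).
have U1 : (#|C1 :|: C2| = #|C1| + #|C2 :\: C1|)%N.
  by rewrite cardsU cardsD setIC; have := subset_leq_card (subsetIl C2 C1); lia.
have U2 : (#|C1 :|: C2| = #|C2| + #|C1 :\: C2|)%N.
  by rewrite cardsU cardsD; have := subset_leq_card (subsetIl C1 C2); lia.
have fE : #|stab C2 :&: stab C1| = #|stab C1 :&: stab C2| by rewrite setIC.
have := stab_union_step cC2' cC1'; have := stab_union_step cC1 cC2.
by rewrite fE /=; apply: stab_union_arith.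
Qed.

(** Dyson's transform, by induction on [#|B|]. If every translate [e + (B - b)] with [e] in [A]
    stays in [A], then [A + b] works, since [B - b] stabilises it. Otherwise some [e] in [A] moves
    elements of [B + (e - b)] lying outside [A] from [B] to [A]; this keeps [#|A| + #|B|], keeps [a]
    and [b], and shrinks [B]. *)
Lemma e_transform A B a b : a \in A -> b \in B ->
  exists C, [/\ C \subset sums A B, a + b \in C & (#|A| + #|B| <= #|C| + #|stab C|)%N].
Proof.
have [m] := ubnP #|B|; elim: m A B => // m IH A B; rewrite ltnS => Bm aA bB.
have [/forall_inP HA|] := boolP [forall e in A, [forall x in B, e + (x - b) \in A]].
  pose C := [set x + b | x in A].
  have memC x : (x \in C) = (x - b \in A).
    by apply/imsetP/idP => [[y yA ->]|xA]; [rewrite addrK|exists (x - b); rewrite ?subrK].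
  have sB : [set x - b | x in B] \subset stab C.
    apply/subsetP => _ /imsetP[x xB ->]; apply/stabP => z.
    have sub : [set e + (x - b) | e in A] \subset A.
      by apply/subsetP => _ /imsetP[e /HA/forall_inP He ->]; apply: He.
    have eqA : [set e + (x - b) | e in A] = A.
      by apply/eqP; rewrite eqEcard sub (card_imset _ (@addIr _ _)) leqnn.
    rewrite !memC -addrA [_ - b + _]addrC addrA.
    by rewrite -{1}eqA (mem_imset _ _ (@addIr _ _)).
  exists C; split; last 1 first.
  - rewrite card_imset; last exact: addIr.
    rewrite leq_add2l -(card_imset (mem B) (@addIr _ (- b))).
    exact: subset_leq_card.
  - by apply/subsetP => _ /imsetP[x xA ->]; apply: mem_sums.
  - by rewrite memC addrK.
rewrite negb_forall_in => /exists_inP[e eA]; rewrite negb_forall_in => /exists_inP[x xB xA].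
pose T := [set y + (e - b) | y in B].
pose B' := [set y in B | y + (e - b) \in A].
have TA : #|T :&: A| = #|B'|.
  rewrite -(card_imset (mem B') (@addIr _ (e - b))); apply: eq_card => y.
  apply/setIP/imsetP => [[/imsetP[z zB ->] zA]|[z + ->]].
    by exists z => //; rewrite inE zB.
  by rewrite inE => /andP[zB zA]; split=> //; apply/imsetP; exists z.
have cT : #|T| = #|B| by rewrite (card_imset _ (@addIr _ _)).
have B'B : (#|B'| < #|B|)%N.
  apply: proper_card; apply/properP; split; first by apply/subsetP => y; rewrite inE => /andP[].
  by exists x => //; rewrite inE xB /= addrCA.
have [|||C [sC abC leC]] := IH (A :|: T) B'.
- exact: leq_trans B'B Bm.
- by rewrite inE aA.
- by rewrite inE bB addrCA subrr addr0.
exists C; split=> //; last first.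
  apply: leq_trans leC; rewrite cardsU [A :&: T]setIC TA cT.
  by have := subset_leq_card (subsetIr T A); rewrite TA; have := subset_leq_card (subsetIl T A); rewrite TA cT; lia.
apply: subset_trans sC _; apply/subsetP => _ /imset2P[u v + + ->].
rewrite inE [v \in _]inE => /orP[uA|/imsetP[y yB ->]] /andP[vB vA].
  exact: mem_sums.
by rewrite addrAC [y + v]addrC addrAC; apply: mem_sums.
Qed.

(** A maximal [T] inside [sums A B] with the stated inequality is all of [sums A B]: for any
    [a + b], the union of [T] with the set [C] from [e_transform] again satisfies it, by
    [stab_setU]. *)
Theorem kneser A B : A != set0 -> B != set0 ->
  (#|A| + #|B| <= #|sums A B| + #|stab (sums A B)|)%N.
Proof.
move=> /set0Pn[a0 a0A] /set0Pn[b0 b0B].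
pose Q := [pred T : {set G} | (T \subset sums A B) && (#|A| + #|B| <= #|T| + #|stab T|)%N].
have [C0 [sC0 _ leC0]] := e_transform a0A b0B.
have QC0 : Q C0 by rewrite /= sC0.
have [T /maxsetP[/andP[sT leT] maxT] _] := maxset_exists QC0.
suff <- : T = sums A B by [].
apply/eqP; rewrite eqEsubset sT /=; apply/subsetP => _ /imset2P[a b aA bB ->].
have [C [sC abC leC]] := e_transform aA bB.
suff <- : T :|: C = T by rewrite inE abC orbT.
apply: maxT; last exact: subsetUl.
rewrite /= subUset sT sC /=.
by case: (stab_setU T C); apply: leq_trans.
Qed.

End Kneser.

(** * Peeling along the cosets of a subgroup *)

Section Cosets.
Variables (G : finZmodType) (H : {set G}).
Hypothesis H0 : 0 \in H.
Hypothesis HB : forall g k, g \in H -> k \in H -> g - k \in H.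
Implicit Types (W : {set G}) (f : G -> nat).

Definition periodic W := forall g k, g \in W -> k \in H -> g + k \in W.

Definition hinv f := forall g k, k \in H -> f (g + k) = f g.

(** Cosets are split off one at a time. The representatives form a list so that the heights over
    them can be passed to [heights_bound]; constant [f] gives divisibility of [#|W|] by [#|H|]. *)
Lemma coset_reps W : periodic W ->
  exists2 rs : seq G, {subset rs <= W} &
    forall f, hinv f -> \sum_(g in W) f g = (#|H| * \sum_(r <- rs) f r)%N.
Proof.
have [m] := ubnP #|W|; elim: m W => // m IH W; rewrite ltnS => Wm pW.
have [->|/set0Pn[x xW]] := eqVneq W set0.
  by exists [::] => // f _; rewrite big_set0 big_nil muln0.
pose K := [set x + k | k in H].
have KW : K \subset W by apply/subsetP => _ /imsetP[k kH ->]; apply: pW.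
have xK : x \in K by apply/imsetP; exists 0; rewrite ?addr0.
have memK g : (g \in K) = (g - x \in H).
  apply/imsetP/idP => [[k kH ->]|gH]; first by rewrite addrC addKr.
  by exists (g - x) => //; rewrite addrC subrK.
have pW' : periodic (W :\: K).
  move=> g k /setDP[gW gK] kH; rewrite in_setD pW // andbT.
  apply: contra gK; rewrite !memK => gkH.
  by have := HB gkH kH; rewrite addrAC addrK.
have cW : (#|W :\: K| < #|W|)%N.
  apply: proper_card; apply/properP; split; first exact: subsetDl.
  by exists x => //; rewrite in_setD xK.
have [rs rsW Hrs] := IH _ (leq_trans cW Wm) pW'.
exists (x :: rs) => [g|f fH].
  by rewrite inE => /predU1P[->//|/rsW/setDP[]].
rewrite big_cons mulnDr -Hrs // (big_setID K) /= (setIidPr KW); congr (_ + _)%N.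
rewrite -sum_nat_const big_imset /=; last by move=> ? ? _ _ /addrI.
by apply: eq_bigr => k kH; rewrite fH.
Qed.

End Cosets.

(** * Sets that are maximal for their sum with [C] *)

Section Closure.
Variables (G : finZmodType) (C : {set G}).
Hypothesis C0 : 0 \in C.
Implicit Types (X Y : {set G}).

(* The largest set with the same sum with C as X. *)
Definition closure X : {set G} := [set g | [forall c in C, g + c \in sums X C]].

Lemma closureP X g :
  reflect (forall c, c \in C -> g + c \in sums X C) (g \in closure X).
Proof. by rewrite inE; apply: (iffP forall_inP). Qed.

Lemma sub_closure X : X \subset closure X.
Proof. by apply/subsetP => g gX; apply/closureP => c cC; apply: mem_sums. Qed.

Lemma sums_closure X : sums (closure X) C = sums X C.
Proof.
apply/eqP; rewrite eqEsubset; apply/andP; split.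
  by apply/subsetP => _ /imset2P[g c /closureP gX cC ->]; apply: gX.
exact/sumsSl/sub_closure.
Qed.

Lemma closureS X Y : X \subset Y -> closure X \subset closure Y.
Proof.
move=> sXY; apply/subsetP => g /closureP gX; apply/closureP => c /gX.
exact/subsetP/sumsSl.
Qed.

Lemma sub_sums X : X \subset sums X C.
Proof. by apply/subsetP => g gX; rewrite -[g]addr0 mem_sums. Qed.

Lemma closure_set0 : closure set0 = set0.
Proof.
by apply/setP => g; rewrite [RHS]inE; apply/closureP => /(_ 0 C0)/sumsP[a]; rewrite inE.
Qed.

End Closure.

(** * Nested counts, and the behaviour of [attained] under small changes *)

Lemma nested_count (P : pred nat) s :
  (forall i j, (i <= j)%N -> P j -> P i) ->
  (0 < \sum_(i < s) P i)%N -> P (\sum_(i < s) P i)%N.-1.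
Proof.
move=> dP; elim: s => [|s IH]; first by rewrite big_ord0.
rewrite big_ord_recr /=; have [Ps|_] := boolP (P s); last by rewrite addn0.
suff -> : (\sum_(i < s) P i = s)%N by rewrite addn1.
rewrite -[RHS]card_ord -sum1_card; apply: eq_bigr => i _.
by rewrite (dP _ _ (ltnW (ltn_ord i)) Ps).
Qed.

Lemma attained_le D a a' E : (a <= a')%N -> attained D a' E -> attained D a E.
Proof. by move=> aa [t Ht]; exists t; lia. Qed.

Lemma attained0 D E : attained D 0 E.
Proof. by exists 0%N. Qed.

(** Passing from [t] to [t + 1] changes [2 * t * E - t * (t + 1) * D] by [2 * (E - (t + 1) * D)],
    which is nonnegative as long as [t + 1 <= s]. *)
Lemma attained_raise D a E s : (s * D <= E)%N -> attained D a E ->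
  exists2 t, (s <= t)%N & (2 * a + t * t.+1 * D <= 2 * t * E)%N.
Proof.
move=> sE [t Ht]; have [st|ts] := leqP s t; first by exists t.
exists s => //.
have [k sk] : exists k, s = (t + k.+1)%N by exists (s - t).-1; lia.
have H1 : ((t + k.+1) * D * k.+1 <= E * k.+1)%N by rewrite leq_mul2r -sk sE orbT.
have H2 : (k.+1 * D <= k.+1 * k.+1 * D)%N by rewrite leq_mul2r leq_pmull ?orbT.
have H3 : (0 <= t * k.+1 * D)%N by [].
by move: H1 H2 Ht; rewrite sk; move: (k.+1) => j; lia.
Qed.

Lemma attained_unit D a E q l s : (s * D + q <= E)%N -> (l <= s * q)%N ->
  attained D a (E - q) -> attained D (a + l) E.
Proof.
move=> sE lq Ha; have [|t st Ht] := @attained_raise D a (E - q) s _ Ha; first by lia.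
exists t.
have H1 : (s * q <= t * q)%N by rewrite leq_mul2r st orbT.
have H2 : (2 * t * (E - q) + 2 * t * q = 2 * t * E)%N by rewrite -mulnDr subnK //; lia.
by lia.
Qed.

Lemma attained_leE D a E E' : (E <= E')%N -> attained D a E -> attained D a E'.
Proof.
move=> EE [t Ht]; exists t; apply: leq_trans Ht _.
by rewrite leq_mul2l EE orbT.
Qed.

(* Induction on c, removing a smallest element of hs at each step. *)
Lemma heights_bound (q w0 : nat) (hs : seq nat) (I Z : nat) :
  all (fun a => a <= I)%N hs ->
  (forall a, a \in hs ->
     q * a + w0 * count (fun b => a <= b)%N hs <= Z + w0 * (q + size hs))%N ->
  forall c, (c <= size hs)%N ->
    (2 * q * sumn hs <= 2 * q * (size hs - c) * I + 2 * c * Z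
      + 2 * w0 * c * q + w0 * (c * c.-1))%N.
Proof.
move=> hI H c; elim: c hs Z hI H => [|c IH] hs Z hI H cs.
  have : (sumn hs <= size hs * I)%N.
    move: hI {H cs}; elim: hs => //= a hs IH' /andP[aI /IH']; lia.
  move/(leq_mul (leqnn (2 * q))); lia.
have [m mhs mmin] : exists2 m, m \in hs & all (fun b => m <= b)%N hs.
  case: hs cs {hI H} => // a hs _; elim: hs a => [|b hs IH'] a.
    by exists a; rewrite ?mem_head //= leqnn.
  have [m mb /= /andP[mb' mh]] := IH' b.
  have [am|ma] := leqP a m.
    exists a; first exact: mem_head.
    rewrite /= leqnn (leq_trans am mb') /=.
    by apply/allP => x /(allP mh); apply: leq_trans.
  exists m; first by rewrite in_cons mb orbT.
  by rewrite /= (ltnW ma) mb'.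
have Hp := perm_to_rem mhs; set hs' := rem m hs in Hp.
have sz : size hs = (size hs').+1 by rewrite (perm_size Hp).
have -> : sumn hs = (m + sumn hs')%N by rewrite (perm_sumn Hp).
have := H _ mhs; move: mmin; rewrite all_count => /eqP -> Hm.
have hI' : all (fun a => a <= I)%N hs'.
  by move: hI; rewrite (perm_all _ Hp) /= => /andP[].
have H' a : a \in hs' -> (q * a + w0 * count (fun b => a <= b)%N hs'
    <= Z + w0 + w0 * (q + size hs'))%N.
  move=> ahs'; have := H a; rewrite (perm_mem Hp) in_cons ahs' orbT => /(_ isT).
  rewrite sz; have /permP -> := Hp; rewrite /=.
  have : (w0 * count (fun b => a <= b)%N hs'
      <= w0 * ((a <= m)%N + count (fun b => a <= b)%N hs'))%N.
    by rewrite leq_mul2l leq_addl orbT.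
  by lia.
have := IH hs' _ hI' H'; rewrite sz in cs Hm * => /(_ cs) Hc.
rewrite subSS.
have cc : (c.+1 * c = c * c.-1 + 2 * c)%N by case: (c) => //= k; lia.
have : (2 * c * (Z + w0) = 2 * c * Z + w0 * (2 * c))%N by lia.
rewrite /= cc; lia.
Qed.

Lemma sum_mem (T : finType) (A : {set T}) : (\sum_z (z \in A) = #|A|)%N.
Proof. by rewrite -sum1_card [RHS]big_mkcond; apply: eq_bigr => z _; case: (_ \in _). Qed.

(** * One peeling step for abstract heights [alpha] of [A] and [v] of [A + B] over [H]-cosets *)

Section Stage.
Variables (G : finZmodType) (C H : {set G}) (alpha v : G -> nat).
Variables (l q e a E : nat).
Hypothesis C0 : 0 \in C.
Hypothesis H0 : 0 \in H.
Hypothesis HB : forall g k, g \in H -> k \in H -> g - k \in H.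
Hypothesis alphaH : hinv H alpha.

Let h := #|H|.
Let D := (q * h + e)%N.
Let w0 := (h - e)%N.
Definition level i : {set G} := [set g | (i < alpha g)%N].
Let S := sums (level 0) C.

Hypothesis e0h : (0 < e < h)%N.
Hypothesis cardL : (#|level 0| = l * h)%N.
Hypothesis cardS : (#|S| = (l + q) * h)%N.
Hypothesis closL : closure C (level 0) = level 0.
Hypothesis sum_alpha : (\sum_g alpha g = h * a)%N.
Hypothesis sum_v : (\sum_g v g = h * (a + E))%N.
Hypothesis v_full : forall g, g \in S -> (alpha g + h <= v g)%N.
Hypothesis v_shift : forall x c, (0 < alpha x)%N -> c \in C -> (alpha x + e <= v (x + c)%R)%N.
Hypothesis alpha_gt : forall x, (0 < alpha x)%N -> (w0 < alpha x)%N.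

Lemma mem_level i g : (g \in level i) = (i < alpha g)%N.
Proof. by rewrite inE. Qed.

Lemma levelS i j : (i <= j)%N -> level j \subset level i.
Proof. by move=> ij; apply/subsetP => g; rewrite !mem_level; apply: leq_ltn_trans. Qed.

Lemma level_low i : (i <= w0)%N -> level i = level 0.
Proof.
move=> iw; apply/setP => g; rewrite !mem_level; apply/idP/idP; first by lia.
by move=> /alpha_gt; lia.
Qed.

Lemma level_periodic i : periodic H (level i).
Proof. by move=> g k; rewrite !mem_level => ag kH; rewrite alphaH. Qed.

Lemma sums_periodic (X : {set G}) : periodic H X -> periodic H (sums X C).
Proof.
move=> pX g k /sumsP[x xX gx] kH; apply/sumsP; exists (x + k); first exact: pX.
by rewrite opprD addrACA subrr addr0.
Qed.

Lemma closure_periodic (X : {set G}) : periodic H X -> periodic H (closure C X).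
Proof.
move=> pX g k /closureP gX kH; apply/closureP => c /gX.
by rewrite addrAC => ?; apply: sums_periodic.
Qed.

Lemma closure_level_sub i : closure C (level i) \subset level 0.
Proof. by rewrite -closL; apply/closureS/levelS. Qed.

Lemma level0_sub_sums : level 0 \subset S.
Proof. exact: sub_sums. Qed.

Let c1 s z := (\sum_(i < s) (z \in sums (level i) C))%N.

Lemma c1_le s z : (c1 s z <= s)%N.
Proof.
rewrite /c1 -[leqRHS]card_ord -sum1_card; apply: leq_sum => i _.
by case: (_ \in _).
Qed.

(** The levels are nested, so [z = x + c] with [c] in [C] and [x] in the level of index
    [c1 s z - 1], that is, [alpha x >= c1 s z]. *)
Lemma c1_v s z : z \in S -> (c1 s z + e <= v z)%N.
Proof.
move=> zS; have [c0|c0] := posnP (c1 s z).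
  by rewrite c0; have := v_full zS; lia.
have dP i j : (i <= j)%N -> z \in sums (level j) C -> z \in sums (level i) C.
  by move=> ij; apply/subsetP/sumsSl/levelS.
have /sumsP[x] := nested_count dP c0; rewrite mem_level -/(c1 s z) => ax zx.
have := v_shift (leq_ltn_trans (leq0n _) ax) zx.
by rewrite addrC subrK; lia.
Qed.

Lemma c1_out s z : z \notin S -> c1 s z = 0%N.
Proof.
move=> zS; apply: big1 => i _; apply/eqP; rewrite eqb0.
by apply: contra zS; apply/subsetP/sumsSl/levelS.
Qed.

Lemma sum_c1 s : (\sum_z c1 s z = \sum_(i < s) #|sums (level i) C|)%N.
Proof.
rewrite exchange_big /=; apply: eq_bigr => i _.
exact: sum_mem.
Qed.

(** Level [0] satisfies this with equality; the first level that fails determines the cosets to be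
    kept. *)
Let good i := (#|closure C (level i)| + q * h <= #|sums (level i) C|)%N.

(* On closed levels all of the excess h = e + w0 of [v_full] is used, below them only [v_shift]. *)
Lemma window s : (0 < s)%N -> (forall i, (i < s)%N -> good i) ->
  (e * #|S| + s * (q * h) + w0 * #|closure C (level s.-1)| <= h * E)%N.
Proof.
move=> s0 gs.
pose c2 z := (\sum_(i < s) (z \in closure C (level i)))%N.
have sum_c2 : (\sum_z c2 z = \sum_(i < s) #|closure C (level i)|)%N.
  rewrite exchange_big /=; apply: eq_bigr => i _.
  exact: sum_mem.
(* The inequality is proved pointwise. On the closure of the top level [c2 z = s], which absorbs
   [c1 s z]; elsewhere on level [0] one has [alpha z < s], so [c2 z] absorbs [alpha z]. *)
have Hz z : (e * (z \in S) + c1 s z + alpha z + w0 * (z \in closure C (level s.-1))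
    <= v z + c2 z)%N.
  have aL : z \notin level 0 -> alpha z = 0%N by rewrite mem_level -eqn0Ngt => /eqP.
  have cL : z \notin level 0 -> (z \in closure C (level s.-1)) = false.
    by move=> zL; apply/negbTE; apply: contra zL; apply/subsetP/closure_level_sub.
  have [zS|zS] := boolP (z \in S); last first.
    have zL : z \notin level 0 by apply: contra zS; apply/subsetP/level0_sub_sums.
    by rewrite (c1_out s zS) aL // cL // !muln0.
  have := c1_v s zS; have := v_full zS; have := c1_le s z.
  have [zL|zL] := boolP (z \in level 0); last by rewrite aL // cL //; lia.
  have [zc|zc] := boolP (z \in closure _ _).
    suff -> : c2 z = s by rewrite /w0; lia.
    rewrite /c2 -[RHS]card_ord -sum1_card; apply: eq_bigr => i _.
    suff -> : z \in closure C (level i) by [].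
    move: zc; apply/subsetP/closureS/levelS; have := ltn_ord i; lia.
  have as_ : (alpha z < s)%N.
    rewrite ltnNge; apply: contra zc => sa.
    by apply: (subsetP (sub_closure _ _)); rewrite mem_level; lia.
  suff : (alpha z <= c2 z)%N by lia.
  rewrite /c2 (bigID (fun i : 'I_s => i < alpha z)%N) /=.
  apply: leq_trans (leq_addr _ _).
  rewrite -[leqLHS](size_iota 0) -(card_ord (size _)) size_iota -sum1_card.
  rewrite (big_ord_widen _ (fun=> 1%N) (ltnW as_)); apply: leq_sum => i ia.
  by rewrite (subsetP (sub_closure _ _)) // mem_level.
have : (\sum_z (e * (z \in S) + c1 s z + alpha z + w0 * (z \in closure C (level s.-1)))
    <= \sum_z (v z + c2 z))%N by apply: leq_sum => z _; apply: Hz.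
rewrite !big_split /= -!big_distrr /= !sum_mem sum_alpha sum_v sum_c1 sum_c2.
have : (\sum_(i < s) (#|closure C (level i)| + q * h) <= \sum_(i < s) #|sums (level i) C|)%N.
  by apply: leq_sum => i _; apply: gs.
rewrite big_split /= sum_nat_const card_ord.
rewrite mulnDr; lia.
Qed.

Hypothesis gen : forall T : {set G}, T != set0 -> sums T C \subset T -> T = setT.
Hypothesis SnT : S != setT.
(** The induction hypothesis on smaller sets, applied to the set obtained by keeping [T] and cutting
    [p] elements over each of its cosets. *)
Hypothesis oracle : forall (T : {set G}) p, periodic H T ->
  (\sum_(g in T) (alpha g - p) < \sum_g alpha g)%N ->
  exists a1 E1, [/\ (h * a1 = \sum_(g in T) (alpha g - p))%N,
    (h * (a1 + E1) <= \sum_(g in sums T C) (v g - p))%N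
    & ((E1 <= E)%N -> attained D a1 E1)].

Lemma card_H_gt0 : (0 < h)%N.
Proof. by move: e0h; lia. Qed.

Lemma card_periodic (X : {set G}) : periodic H X -> exists n, #|X| = (h * n)%N.
Proof.
move=> /(coset_reps H0 HB)[rs _ Hrs]; exists (size rs).
by rewrite -sum1_card (Hrs (fun=> 1%N)) // sum1_size.
Qed.

Lemma sum_split (f : G -> nat) (X Y : {set G}) : X \subset Y ->
  (\sum_(g in Y) f g = \sum_(g in X) f g + \sum_(g in Y :\: X) f g)%N.
Proof. by move=> XY; rewrite (big_setID X) /= (setIidPr XY). Qed.

Lemma sum_alphaL : (\sum_g alpha g = \sum_(g in level 0) alpha g)%N.
Proof.
rewrite [RHS]big_mkcond; apply: eq_bigr => g _; rewrite mem_level.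
by case: posnP.
Qed.

Lemma sum_pos (X : {set G}) (f : G -> nat) : (forall g, g \in X -> 0 < f g)%N ->
  (\sum_(g in X) (f g - 1) + #|X| = \sum_(g in X) f g)%N.
Proof.
move=> f0; rewrite -sum1_card -big_split /=; apply: eq_bigr => g /f0 ?.
by rewrite subnK.
Qed.

(** Cutting one element over every coset removes [l] elements and lowers [E] by at least [q], which
    is what [attained_unit] needs. *)
Lemma unit_peel s : (0 < l)%N -> (s * D + q <= E)%N -> (l <= s * q)%N -> attained D a E.
Proof.
move=> l0 sE lq.
have Sa : (\sum_(g in [set: G]) (alpha g - 1) + l * h = h * a)%N.
  rewrite -sum_alpha sum_alphaL -[RHS]sum_pos => [|g]; last by rewrite mem_level.
  rewrite cardL; congr (_ + _)%N; rewrite [RHS]big_mkcond; apply: eq_big => [g|g _].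
    by rewrite inE.
  by rewrite mem_level; case: posnP => // ->.
have Sv : (\sum_(g in sums setT C) (v g - 1) + (l + q) * h <= h * (a + E))%N.
  rewrite -sum_v -cardS [leqRHS](bigID (mem S)) /= -(@sum_pos S v) => [|g /v_full]; last first.
    by have := card_H_gt0; lia.
  rewrite addnAC leq_add2r; apply: (@leq_trans (\sum_g (v g - 1))).
    by rewrite [leqLHS]big_mkcond; apply: leq_sum => g _; case: ifP.
  rewrite [leqLHS](bigID (mem S)) /= leq_add2l; apply: leq_sum => g _; exact: leq_subr.
have lh : (0 < l * h)%N by rewrite muln_gt0 l0 card_H_gt0.
have [||a1 [E1 [Ha HE Hat]]] := @oracle setT 1%N; rewrite ?sum_alpha.
- by move=> *; rewrite inE.
- by lia.
have ea : (a1 + l = a)%N.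
  by apply/eqP; rewrite -(eqn_pmul2l card_H_gt0) mulnDr Ha -Sa [(l * h)%N]mulnC.
have eE : (E1 + q <= E)%N.
  rewrite -(leq_pmul2l card_H_gt0); move: HE Sv; rewrite -ea; lia.
rewrite -ea; apply: attained_unit sE lq _.
by apply: attained_leE (Hat _); lia.
Qed.

Lemma stage_attained : attained D a E.
Proof.
have h0 := card_H_gt0.
have [l0|l0] := posnP l.
  move: cardL sum_alpha; rewrite l0 mul0n sum_alphaL => /cards0_eq ->.
  rewrite big_set0 => /esym/eqP; rewrite muln_eq0 => /orP[/eqP|/eqP ->]; first by lia.
  exact: attained0.
have L0 : level 0 != set0 by rewrite -cards_eq0 cardL muln_eq0; lia.
have q0 : (0 < q)%N.
  rewrite lt0n; apply: contraNneq SnT => q0.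
  have LS : level 0 = S by apply/eqP; rewrite eqEcard level0_sub_sums cardL cardS q0 addn0 leqnn.
  by rewrite -LS; apply/eqP/gen => //; rewrite -/S -LS.
have [s /andP[sE lq]|flat] := pickP (fun s : 'I_E.+1 => (s * D + q <= E)%N && (l <= s * q)%N).
  exact: unit_peel sE lq.
have {}flat s : (s * D + q <= E)%N -> (s * q < l)%N.
  move=> sE; rewrite ltnNge; apply/negP => lq.
  have sE' : (s < E.+1)%N.
    have : (s * 1 <= s * D)%N by rewrite leq_mul2l /D; lia.
    by lia.
  by have := flat (Ordinal sE'); rewrite /= sE lq.
pose bad i := ~~ good i.
(* At the maximal height the level is empty and gains nothing, while [q * h > 0]. *)
have exbad : exists i, bad i.
  exists (\max_g alpha g); rewrite /bad /good.
  have -> : level (\max_g alpha g) = set0.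
    by apply/setP => g; rewrite mem_level inE ltnNge leq_bigmax.
  have -> : sums set0 C = set0 by apply/setP => g; rewrite inE; apply/negP => /sumsP[x]; rewrite inE.
  by rewrite closure_set0 // cards0 -ltnNge add0n muln_gt0 q0.
case: (ex_minnP exbad) => I badI minI.
have goodI i : (i < I)%N -> good i.
  by move=> iI; apply: contraTT iI => /minI; rewrite -leqNgt.
(* All levels up to [w0] coincide with level [0], which is good. *)
have Iw : (w0 < I)%N.
  rewrite ltnNge; apply: contra badI => Iw.
  by rewrite /good level_low // closL cardL -/S cardS mulnDl.
pose T := closure C (level I).
have sT : sums T C = sums (level I) C by apply: sums_closure.
have cT : (#|sums T C| < #|T| + q * h)%N by rewrite sT ltnNge.
have TL : T \subset level 0 by apply: closure_level_sub.
have pT : periodic H T by apply/closure_periodic/level_periodic.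
have [lam Elam] := card_periodic pT.
pose W := level 0 :\: T.
have pW : periodic H W.
  move=> g k /setDP[gL gT] kH; rewrite in_setD level_periodic // andbT.
  apply: contra gT => gkT; rewrite -[g](addrK k) -[- k]sub0r.
  by apply: pT => //; apply: HB.
have [rs rsW Hrs] := coset_reps H0 HB pW.
set w := size rs.
have cW : #|W| = (h * w)%N.
  by rewrite -sum1_card (Hrs (fun=> 1%N)) // sum1_size.
have clw : (#|level 0| = #|T| + #|W|)%N by rewrite (cardsD _ T) (setIidPr TL); have := subset_leq_card TL; lia.
have lE : l = (lam + w)%N.
  by apply/eqP; rewrite -(eqn_pmul2r h0) -cardL clw Elam cW mulnDl mulnC [(w * h)%N]mulnC.
have w1 : (0 < w)%N.
  rewrite lt0n; apply: contraTneq cT => w0'.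
  have TE : T = level 0.
    by apply/eqP; rewrite eqEcard TL clw cW w0' muln0 addn0 leqnn.
  by rewrite -leqNgt TE -/S cardS cardL mulnDl.
(* If [q = 1], then [#|sums T C| < #|T| + h] with both sizes divisible by [h], so [T + C = T]. By
   [gen] a nonempty [T] is then the whole group, hence so is [S], against [SnT]. *)
have Hq : lam = 0%N \/ (1 < q)%N.
  have [q1|q1] := leqP q 1; last by right.
  left; have {q1}q1 : q = 1%N by lia.
  have [m Em] := card_periodic (sums_periodic pT).
  have TsT : T \subset sums T C by apply: sub_sums.
  have : (#|sums T C| <= #|T|)%N.
    by move: cT; rewrite Em Elam q1 mul1n -mulnSr ltn_pmul2l // ltnS leq_pmul2l.
  move=> le; have sTT : T = sums T C by apply/eqP; rewrite eqEcard TsT.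
  have [T0|Tn0] := eqVneq T set0.
    by move: Elam; rewrite T0 cards0 => /esym/eqP; rewrite muln_eq0 => /orP[]/eqP //; lia.
  have TT : T = setT by apply: gen => //; rewrite -sTT.
  have LT : level 0 = setT by apply/eqP; rewrite eqEsubset subsetT -TT.
  by case/negP: SnT; rewrite eqEsubset subsetT /S -LT level0_sub_sums.
(* This is [window] at [s = w0 + 1], where the top level is still level [0]. *)
have Hz : ((lam + w + q) * h + q <= E)%N.
  have := @window w0.+1 isT; rewrite /= level_low // closL cardL cardS -lE.
  have /[swap]/[apply] : forall i : nat, (i < w0.+1)%N -> good i.
    by move=> i iw; apply: goodI; apply: leq_ltn_trans Iw.
  move=> Hw; rewrite -(leq_pmul2l h0); apply: leq_trans Hw; rewrite eq_leq //.
  have -> : h = (e + w0)%N by rewrite /w0; lia.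
  ring.
pose Wt := (\sum_(r <- rs) alpha r)%N.
have EWt : (\sum_(g in W) alpha g = h * Wt)%N by rewrite Hrs.
have WI g : g \in W -> (0 < alpha g <= I)%N.
  case/setDP => gL gT; rewrite -mem_level gL /= leqNgt -mem_level.
  by apply: contra gT; apply/subsetP/sub_closure.
(* The heights over the deleted cosets satisfy the premise of [heights_bound]: apply [window] at
   [s = alpha x], whose top closure contains both [T] and all deleted cosets at least as high as
   [x]. *)
have HR c : (c <= w)%N -> (2 * q * Wt <= 2 * q * (w - c) * I + 2 * c * (E - (lam + w + q) * h)
      + 2 * w0 * c * q + w0 * (c * c.-1))%N.
  pose hs := map alpha rs.
  have -> : Wt = sumn hs by rewrite /Wt /hs sumnE big_map.
  have shs : size hs = w by rewrite size_map.
  rewrite -shs; apply: heights_bound.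
    by apply/allP => _ /mapP[r /rsW/WI/andP[_ ?] ->].
  move=> _ /mapP[x /rsW xW ->]; have /andP[ax0 axI] := WI _ xW; rewrite shs count_map.
  have Hw := window ax0 (fun i ia => goodI i (leq_trans ia axI)).
  set n := count _ rs.
  have En : (#|[set g in W | (alpha x <= alpha g)%N]| = h * n)%N.
    rewrite -sum_mem /n -sum1_count.
    have -> : (\sum_(z : G) (z \in [set g in W | (alpha x <= alpha g)%N]) =
      \sum_(z in W) (alpha x <= alpha z)%N)%N.
      rewrite [RHS]big_mkcond; apply: eq_bigr => z _; rewrite inE.
      by case: (z \in W).
    rewrite (Hrs (fun z => nat_of_bool (alpha x <= alpha z)%N)) => [|g k kH]; last by rewrite alphaH.
    by rewrite [in RHS]big_mkcond; congr (_ * _)%N; apply: eq_bigr => r _ /=; case: (_ <= _)%N.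
  have : (#|T| + #|[set g in W | (alpha x <= alpha g)%N]| <= #|closure C (level (alpha x).-1)|)%N.
    rewrite -cardsUI (_ : T :&: _ = set0) ?cards0 ?addn0; last first.
      apply/setP => g; rewrite in_set0; apply/negP => /setIP[gT /setIdP[/setDP[_ /negP]]].
      by move/(_ gT).
    apply: subset_leq_card; apply/subsetP => g /setUP[|/setIdP[gW xg]].
      by apply/subsetP/closureS/levelS; lia.
    by apply: (subsetP (sub_closure _ _)); rewrite mem_level; lia.
  rewrite Elam En => Hc; rewrite -(leq_pmul2l h0).
  have {}Hc : (w0 * (h * lam + h * n) <= w0 * #|closure C (level (alpha x).-1)|)%N.
    by rewrite leq_mul2l Hc orbT.
  have hwe : h = (w0 + e)%N by rewrite /w0; lia.
  have Ez : (E = (lam + w + q) * h + (E - (lam + w + q) * h))%N by lia.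
  move: Hw; rewrite cardS lE => Hw.
  set Z := (E - _)%N in Ez *; rewrite Ez in Hw.
  have Hx : (e * ((lam + w + q) * h) + w0 * ((lam + w + q) * h) = h * ((lam + w + q) * h))%N.
    by rewrite -mulnDl addnC -hwe.
  move: Hw Hc Hx; move: (#|closure _ _|) => cc; clear; lia.
have hI : (h < I + e)%N by move: Iw; rewrite /w0; lia.
have [|p [pI Hp]] := @peel_choice q h e lam w I Wt E q0 e0h w1 hI Hq Hz _ HR.
  by move=> s; rewrite -lE; apply: flat.
have sa : (h * a = \sum_(g in T) alpha g + h * Wt)%N.
  by rewrite -sum_alpha sum_alphaL (sum_split _ TL) EWt.
have [lam0|lam0] := posnP lam.
  have T0 : T = set0 by apply/cards0_eq; rewrite Elam lam0 muln0.
  have -> : a = (0 + p * lam + Wt)%N.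
    by apply/eqP; rewrite -(eqn_pmul2l h0) sa T0 big_set0 lam0 muln0.
  by apply: (Hp 0%N 0%N) => //; [left|apply: attained0].
case: pI => [|pI]; first by lia.
have WT : (\sum_(g in T) alpha g <= \sum_(g in T) (alpha g - p) + p * #|T|)%N.
  rewrite mulnC -sum_nat_const -big_split /=; apply: leq_sum => g _; lia.
have [|a1 [E1 [Ha HE Hat]]] := @oracle T p pT.
  rewrite sum_alpha sa; have : (0 < h * Wt)%N.
    rewrite -EWt; apply: leq_trans (_ : 0 < #|W|)%N _; first by rewrite cW muln_gt0 h0.
    by rewrite -sum1_card; apply: leq_sum => g /WI /andP[].
  suff : (\sum_(g in T) (alpha g - p) <= \sum_(g in T) alpha g)%N by lia.
  by apply: leq_sum => g _; apply: leq_subr.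
(* Over [sums T C] the heights of [A + B] exceed [I + e], so the full [p] is cut there. Over the
   rest of [S] they are at least [c1 I g + e]. Summing over levels below [I], each closure contains
   the disjoint sets [T] and [W :&: level i], and the latter have total size [h * Wt]. *)
have EE : (E1 + (p * q + w * e) <= E)%N.
  rewrite -(leq_pmul2l h0).
  have sTS : sums T C \subset S by apply: sumsSl.
  have Sv : (\sum_(g in sums T C) v g + \sum_(g in S :\: sums T C) v g <= h * (a + E))%N.
    rewrite -sum_split // -sum_v [leqLHS]big_mkcond; apply: leq_sum => g _.
    by case: ifP.
  have Svp : (\sum_(g in sums T C) (v g - p) + p * #|sums T C| <= \sum_(g in sums T C) v g)%N.
    rewrite mulnC -sum_nat_const -big_split /=; apply: leq_sum => g.
    rewrite sT => /sumsP[x]; rewrite mem_level => Ix gx.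
    have := v_shift (leq_ltn_trans (leq0n _) Ix) gx; rewrite addrC subrK; lia.
  have Sc : (e * #|S| + \sum_(i < I) #|sums (level i) C| <=
      \sum_(g in S :\: sums T C) v g + (I + e) * #|sums T C|)%N.
    rewrite -sum_c1 -!sum_mem !big_distrr -big_split /= [X in (X + _)%N]big_mkcond -big_split /=.
    apply: leq_sum => g _; rewrite in_setD; have := c1_le I g.
    have [gT|gT] := boolP (g \in sums T C).
      by rewrite (subsetP sTS) //; lia.
    by have [/(c1_v I)|/(c1_out I)] := boolP (g \in S); rewrite /=; lia.
  have Sg : (\sum_(i < I) (#|T| + q * h) + h * Wt <= \sum_(i < I) #|sums (level i) C|)%N.
    have -> : (h * Wt = \sum_(i < I) #|W :&: level i|)%N.
      rewrite -EWt; under [RHS]eq_bigr => i _ do rewrite -sum_mem.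
      rewrite exchange_big /= [LHS]big_mkcond; apply: eq_bigr => g _.
      under eq_bigr => i _ do rewrite in_setI mem_level.
      have [/WI/andP[_ gI]|_] := boolP (g \in W); last by rewrite big1.
      rewrite -[LHS]card_ord -sum1_card (big_ord_widen _ (fun=> 1%N) gI) big_mkcond /=.
      by apply: eq_bigr => i _; case: (_ < _)%N.
    rewrite -big_split /=; apply: leq_sum => i _; apply: leq_trans (goodI i (ltn_ord i)).
    rewrite addnAC leq_add2r -cardsUI (_ : T :&: _ = set0) ?cards0 ?addn0; last first.
      apply/setP => g; rewrite in_set0; apply/negP => /setIP[gT /setIP[/setDP[_ /negP]]].
      by move/(_ gT).
    apply: subset_leq_card; apply/subsetP => g /setUP[|/setIP[_ gi]].
      by apply/subsetP/closureS/levelS; have := ltn_ord i; lia.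
    exact: (subsetP (sub_closure _ _)).
  rewrite sum_nat_const card_ord in Sg.
  have SL : (#|S| = #|T| + #|W| + q * h)%N by rewrite -clw cardS cardL mulnDl.
  have [k Ek] : exists k, (I + e = p + k)%N by exists (I + e - p)%N; lia.
  have Hk : (k * #|sums T C| <= k * (#|T| + q * h))%N by rewrite leq_mul2l (ltnW cT) orbT.
  rewrite SL Ek in Sc.
  have e1 : (e * (#|T| + q * h) + I * (#|T| + q * h) = p * (#|T| + q * h) + k * (#|T| + q * h))%N.
    by rewrite -!mulnDl addnC Ek.
  have e2 : (h * (p * q + w * e) = p * (q * h) + e * #|W|)%N by rewrite cW; ring.
  rewrite mulnDr e2.
  move: Sv Svp Sc Sg Hk e1 WT sa HE; rewrite -Ha !mulnDr !mulnDl; clear; lia.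
apply: (@attained_le _ _ (a1 + p * lam + Wt)).
  rewrite -(leq_pmul2l h0) sa; move: WT; rewrite Elam -Ha; clear; lia.
apply: (Hp a1 E1) => //; [by lia | by right | by apply: Hat; lia].
Qed.
End Stage.

(** * Sumsets of integers and their columns *)

Local Open Scope fset_scope.
Local Open Scope ring_scope.

Lemma fset_max (X : {fset int}) : X != fset0 -> exists2 m, m \in X & forall x, x \in X -> x <= m.
Proof.
case/fset0Pn => x0 x0X.
have [m _ mP] := @arg_maxP _ int _ [` x0X] xpredT val isT.
by exists (val m) => [|x xX]; [exact: valP|exact: (mP [` xX])].
Qed.

Lemma fset_min (X : {fset int}) : X != fset0 -> exists2 m, m \in X & forall x, x \in X -> m <= x.
Proof.
case/fset0Pn => x0 x0X.
have [m _ mP] := @arg_minP _ int _ [` x0X] xpredT val isT.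
by exists (val m) => [|x xX]; [exact: valP|exact: (mP [` xX])].
Qed.

Lemma mem_sumset (A B : {fset int}) a b : a \in A -> b \in B -> a + b \in sumset A B.
Proof. by move=> aA bB; apply/imfset2P; exists a => //; exists b. Qed.

Lemma sumsetP (A B : {fset int}) x :
  reflect (exists a b, [/\ a \in A, b \in B & x = a + b]) (x \in sumset A B).
Proof.
apply: (iffP idP) => [/imfset2P[a /= aA [b /= bB ->]]|[a [b [aA bB ->]]]].
  by exists a, b.
exact: mem_sumset.
Qed.

(** The translates [X + min Y] and [max X + Y] share only the point [max X + min Y]. *)
Lemma card_sumset_ge (X Y : {fset int}) : X != fset0 -> Y != fset0 ->
  (#|` X| + #|` Y| <= #|` sumset X Y| + 1)%N.
Proof.
move=> /fset_max[m mX mmax] /fset_min[u uY umin].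
pose P := [fset x + u | x in X]; pose Q := [fset m + y | y in Y].
have cP : #|` P| = #|` X| by rewrite card_imfset //=; apply: addIr.
have cQ : #|` Q| = #|` Y| by rewrite card_imfset //=; apply: addrI.
have PQ : P `|` Q `<=` sumset X Y.
  apply/fsubsetP => z; rewrite inE => /orP[]/imfsetP[y /= yY ->]; exact: mem_sumset.
have PIQ : P `&` Q `<=` [fset m + u].
  apply/fsubsetP => z; rewrite !inE => /andP[/imfsetP[x /= xX ->] /imfsetP[y /= yY E]].
  by have := mmax _ xX; have := umin _ yY; lia.
have := fsubset_leq_card PQ; have := fsubset_leq_card PIQ; rewrite cardfs1 -cP -cQ.
move: (cardfsUI P Q); move: #|` P| #|` Q| #|` _ `|` _| #|` _ `&` _| #|` sumset _ _| => *; lia.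
Qed.

Lemma card_drop_top (X : {fset int}) p :
  #|` [fset a in X | (p <= #|` [fset b in X | (a < b)%R]|)%N]| = (#|` X| - p)%N.
Proof.
have [k] := ubnP #|` X|; elim: k X => // k IH X; rewrite ltnS => Xk.
have [->|X0] := eqVneq X fset0.
  by rewrite cardfs0 sub0n; apply/eqP; rewrite cardfs_eq0; apply/eqP/fsetP => a; rewrite !inE.
have [m mX mmin] := fset_min X0.
pose X' := X `\ m.
have cX : #|` X| = #|` X'|.+1 by rewrite (cardfsD1 m) mX.
have rk a : a \in X' -> [fset b in X | (a < b)%R] = [fset b in X' | (a < b)%R].
  rewrite !inE => /andP[am aX]; apply/fsetP => b; rewrite !inE /=.
  have := mmin _ aX; case: (b =P m) => //= -> H; lia.
have rm : [fset b in X | (m < b)%R] = X'.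
  apply/fsetP => b; rewrite !inE /=; case: (boolP (b \in X)) => bX; rewrite ?andbF //=.
  by have := mmin _ bX; lia.
set Y := [fset a in X' | (p <= #|` [fset b in X' | (a < b)%R]|)%N].
have cY : #|` Y| = (#|` X'| - p)%N by apply: IH; lia.
have mY : m \notin Y by rewrite !inE eqxx.
have [pX|pX] := leqP p #|` X'|.
  have -> : [fset a in X | (p <= #|` [fset b in X | (a < b)%R]|)%N] = m |` Y.
    apply/fsetP => a; rewrite !inE; have [->|am] /= := eqVneq a m; first by rewrite rm mX.
    by have [aX|//] := boolP (a \in X); rewrite /= rk // !inE am.
  by rewrite cardfsU1 mY cY cX; lia.
have -> : [fset a in X | (p <= #|` [fset b in X | (a < b)%R]|)%N] = Y.
  apply/fsetP => a; rewrite !inE; have [->|am] /= := eqVneq a m; first by rewrite rm mX /= leqNgt pX.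
  by have [aX|//] := boolP (a \in X); rewrite /= rk // !inE am.
by rewrite cY cX; lia.
Qed.

Lemma card_fset_cond (A : {fset int}) (P : pred int) :
  #|` [fset a in A | P a]| = (\sum_(a <- A) P a)%N.
Proof.
rewrite card_fset_sum1 -big_fset_condE /= [LHS]big_mkcond.
by apply: eq_bigr => a _; case: (P a).
Qed.

(** * Columns of integer sets over the cosets of a finite quotient *)

Section Columns.
Variables (G : finZmodType) (phi : int -> G).
Hypothesis phiD : {morph phi : x y / x + y}.
Implicit Types (H T : {set G}) (A B : {fset int}).

Lemma phi_0 : phi 0 = 0.
Proof. by apply: (addrI (phi 0)); rewrite -phiD !addr0. Qed.

Lemma phi_N x : phi (- x) = - phi x.
Proof. by apply/eqP; rewrite -addr_eq0 -phiD addNr phi_0. Qed.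

Lemma phi_B x y : phi (x - y) = phi x - phi y.
Proof. by rewrite phiD phi_N. Qed.

Definition image A : {set G} := [set g | g \in [fset phi a | a in A]].

Lemma imageP A g : reflect (exists2 a, a \in A & g = phi a) (g \in image A).
Proof.
rewrite inE; apply: (iffP idP) => [/imfsetP[a /= aA ->]|[a aA ->]]; first by exists a.
by apply/imfsetP; exists a.
Qed.

Lemma mem_image A a : a \in A -> phi a \in image A.
Proof. by move=> aA; apply/imageP; exists a. Qed.

Lemma image_sumset A B : image (sumset A B) = sums (image A) (image B).
Proof.
apply/setP => g; apply/imageP/imset2P => [[_ /sumsetP[a [b [aA bB ->]]] ->]|].
  by exists (phi a) (phi b); rewrite ?mem_image ?phiD.
case=> _ _ /imageP[a aA ->] /imageP[b bB ->] ->.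
by exists (a + b); rewrite ?phiD ?mem_sumset.
Qed.

Definition col H A g : {fset int} := [fset a in A | phi a - g \in H].
Definition cnt H A g := #|` col H A g|.

Lemma in_col H A g a : (a \in col H A g) = (a \in A) && (phi a - g \in H).
Proof. by rewrite !inE. Qed.

Lemma cntE H A g : cnt H A g = (\sum_(a <- A) ((phi a - g)%R \in H))%N.
Proof. exact: card_fset_cond. Qed.

Lemma sum_cnt H A : (\sum_g cnt H A g = #|H| * #|` A|)%N.
Proof.
under eq_bigr => g _ do rewrite cntE.
rewrite exchange_big /= card_fset_sum1 big_distrr /=; apply: eq_bigr => a _.
rewrite muln1 -sum_mem (reindex_inj (inv_inj (subKr (phi a)))) /=.
by apply: eq_bigr => g _; rewrite subKr.
Qed.

Lemma cnt_cosets H A g : cnt H A g = (\sum_(k in H) cnt [set 0%R] A (g + k)%R)%N.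
Proof.
rewrite cntE; under [RHS]eq_bigr => k _ do rewrite cntE.
rewrite exchange_big /=; apply: eq_bigr => a _.
have E k : (phi a - (g + k) \in [set 0]) = (k == phi a - g).
  by rewrite in_set1 opprD addrA subr_eq0 eq_sym.
under eq_bigr => k _ do rewrite E.
have [aH|aH] := boolP (_ \in H).
  by rewrite (bigD1 (phi a - g)) //= eqxx big1 // => k /andP[_ /negbTE ->].
by rewrite big1 // => k kH; apply/eqP; rewrite eqb0; apply: contraNneq aH => <-.
Qed.

Section Peel.
Variable H : {set G}.
Hypothesis H0 : 0 \in H.
Hypothesis HB : forall g k, g \in H -> k \in H -> g - k \in H.

Lemma subgroupN k : k \in H -> - k \in H.
Proof. by move=> kH; rewrite -sub0r; apply: HB. Qed.

Lemma subgroupD g k : g \in H -> k \in H -> g + k \in H.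
Proof. by move=> gH kH; rewrite -[k]opprK; apply/HB/subgroupN. Qed.

Lemma subgroupDr g k : k \in H -> (g + k \in H) = (g \in H).
Proof.
move=> kH; apply/idP/idP => [gk|gH]; last exact: subgroupD.
by rewrite -(addrK k g); apply: HB.
Qed.

Lemma cnt_hinv A : hinv H (cnt H A).
Proof.
move=> g k kH; congr #|` _|; apply/fsetP => a; rewrite !in_col.
by rewrite opprD addrA (subgroupDr _ (subgroupN kH)).
Qed.

Lemma cnt_gt0 A g : reflect (exists2 a, a \in A & phi a - g \in H) (0 < cnt H A g)%N.
Proof.
rewrite cardfs_gt0; apply: (iffP (fset0Pn _)) => [[a]|[a aA ag]].
  by rewrite in_col => /andP[aA ag]; exists a.
by exists a; rewrite in_col aA.
Qed.

(* Over each coset in T the p largest elements of A are removed; all elements over other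
   cosets are removed. *)
Definition peel A T p : {fset int} :=
  [fset a in A | (phi a \in T) && (p <= #|` [fset b in col H A (phi a) | (a < b)%R]|)%N].

Lemma col_eq A g x : x - g \in H -> col H A x = col H A g.
Proof.
move=> xg; apply/fsetP => a; rewrite !in_col; congr (_ && _).
by rewrite -[in RHS](subrK x (phi a)) -addrA (subgroupDr _ xg).
Qed.

Lemma cnt_peel A T p g : periodic H T -> g \in T -> cnt H (peel A T p) g = (cnt H A g - p)%N.
Proof.
move=> pT gT; rewrite /cnt -card_drop_top; congr #|` _|; apply/fsetP => a.
rewrite in_col !inE /=; case: (a \in A) => //=.
have [ag|] := boolP (_ \in H); rewrite ?andbF //= andbT (col_eq A ag).
by have -> : phi a \in T by rewrite -[phi a](subrK g) addrC pT.
Qed.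

Lemma cnt_peel_out A T p g : periodic H T -> g \notin T -> cnt H (peel A T p) g = 0%N.
Proof.
move=> pT gT; apply/eqP; rewrite cardfs_eq0; apply/eqP/fsetP => a; rewrite in_col inE /=.
rewrite !inE; apply/negbTE; apply: contra gT => /andP[/andP[_ /andP[aT _]] ag].
by rewrite -[g](addrK (phi a)) addrAC -opprB addrC; apply: pT => //; apply: subgroupN.
Qed.

(** Let [x = a + b] be the largest element over [g] of the peeled sumset. At least [p] larger
    elements of [A] lie over the coset of [a]; adding [b] to them gives elements of [A + B] over [g]
    beyond [x]. *)
Lemma cnt_peel_sumset A B T p g : periodic H T ->
  (cnt H (sumset (peel A T p) B) g <=
     if g \in sums T (image B) then cnt H (sumset A B) g - p else 0)%N.
Proof.
move=> pT; set X := col H (sumset (peel A T p) B) g.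
have [X0|/fset_max[x xX xmax]] := eqVneq X fset0; first by rewrite /cnt -/X X0 cardfs0.
move: (xX); rewrite in_col => /andP[/sumsetP[a [b [aP bB xE]]] xg].
move: (aP); rewrite !inE /= => /andP[aA /andP[aT pa]].
have gS : g \in sums T (image B).
  apply/sumsP; exists (phi a - (phi x - g)); first by apply/pT/subgroupN.
  by rewrite opprB addrA [g + _]addrC subrK xE phiD addrC addKr mem_image.
rewrite gS.
pose W := [fset y in col H A (phi a) | (a < y)%R].
pose U := [fset y + b | y in W].
have cU : #|` U| = #|` W| by rewrite card_imfset //=; apply: addIr.
have XU : X `|` U `<=` col H (sumset A B) g.
  apply/fsubsetP => z; rewrite inE => /orP[|/imfsetP[y /= yW ->]].
    rewrite !in_col => /andP[/sumsetP[a' [b' [a'P b'B ->]]] ->]; rewrite andbT.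
    by apply: mem_sumset => //; move: a'P; rewrite !inE /= => /andP[].
  have /and3P[yA ya _] : [&& y \in A, phi y - phi a \in H & a < y].
    by move: yW; rewrite !inE /= -andbA.
  rewrite in_col mem_sumset //=.
  have -> : phi (y + b) - g = (phi y - phi a) + (phi x - g).
    by rewrite xE !phiD addrA [_ - _ + _]addrA subrK.
  exact: subgroupD.
have XIU : [disjoint X & U]%fset.
  apply/fdisjointP => z /xmax zx; apply/negP => /imfsetP[y /= yW zE].
  have ay : a < y by move: yW; rewrite !inE => /andP[].
  by move: zx; rewrite zE xE; lia.
have := fsubset_leq_card XU; rewrite cardfsU.
move: XIU; rewrite -fsetI_eq0 => /eqP ->; rewrite cardfs0 cU /cnt -/X.
move: pa; rewrite -/W; move: #|` W| #|` X| #|` _| => *; lia.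
Qed.

End Peel.
End Columns.

Lemma sum_setT (T : finType) (f : T -> nat) : (\sum_(g in [set: T]) f g = \sum_g f g)%N.
Proof. by apply: eq_bigl => g; rewrite inE. Qed.

(** The points of one coset in [W] missed by [X] are among all those that [X] misses in [W]. *)
Lemma holes (G : finZmodType) (H X W : {set G}) g : X \subset W -> periodic H W -> g \in W ->
  (#|H| + #|X| <= #|W| + #|[set x in X | (x - g)%R \in H]|)%N.
Proof.
move=> XW pW gW.
pose K := [set x | x - g \in H].
have cK : #|K| = #|H| by rewrite -(card_preimset H (@addIr _ (- g))); apply: eq_card => x; rewrite !inE.
have KW : K \subset W.
  by apply/subsetP => x; rewrite inE => xg; rewrite -[x](subrK g) addrC pW.
have -> : [set x in X | (x - g)%R \in H] = X :&: K by apply/setP => x; rewrite !inE.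
have := subset_leq_card (setSD K XW); have := cardsID K X; have := cardsID K W.
rewrite (setIidPr KW) -cK; move: #|K| #|X| #|W| #|_ :\: _| #|W :\: K| #|X :&: K|; lia.
Qed.

(** * The dichotomy in the quotient where [0] and [n = max B] coincide *)

Section Cyclic.
Variables (G : finZmodType) (phi : int -> G).
Hypothesis phiD : {morph phi : x y / x + y}.
Variables (B : {fset int}) (n : int).
Hypothesis n0 : 0 < n.
Hypothesis phin : phi n = 0.
Hypothesis B0 : 0 \in B.
Hypothesis Bn : n \in B.
Let C := image phi B.
Hypothesis cardC : #|C|.+1 = #|` B|.
Hypothesis B2 : (1 < #|` B|)%N.
Hypothesis gen : forall T : {set G}, T != set0 -> sums T C \subset T -> T = setT.
Implicit Types (A X : {fset int}) (H : {set G}).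

Let cnt0 := cnt phi [set 0].

Lemma C0 : 0 \in C.
Proof. by rewrite -(phi_0 phiD) mem_image. Qed.

Lemma in_col0 X g x : (x \in col phi [set 0] X g) = (x \in X) && (phi x == g).
Proof. by rewrite in_col inE subr_eq0. Qed.

Lemma cnt_image X g : g \in image phi X -> (0 < cnt0 X g)%N.
Proof.
case/imageP => x xX ->; rewrite cardfs_gt0; apply/fset0Pn; exists x.
by rewrite in_col0 xX eqxx.
Qed.

Lemma cnt_notimage X g : g \notin image phi X -> cnt0 X g = 0%N.
Proof.
move=> gX; apply/eqP; rewrite cardfs_eq0; apply/eqP/fsetP => x; rewrite in_col0 in_fset0.
by apply: contraNF gX => /andP[xX /eqP <-]; apply: mem_image.
Qed.

(** Both [0] and [n] lie in [B] and vanish under [phi]: the column of [A] reappears in [A + B],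
    extended by its maximum plus [n]. *)
Lemma column_gain A g : g \in sums (image phi A) C ->
  (cnt0 A g < cnt0 (sumset A B) g)%N.
Proof.
rewrite -(image_sumset phiD) => gS.
have [c0|] := posnP (cnt0 A g); first by rewrite c0 cnt_image.
rewrite cardfs_gt0 => /fset_max[m mX mmax].
move: (mX); rewrite in_col0 => /andP[mA /eqP mg].
have sub : m + n |` col phi [set 0] A g `<=` col phi [set 0] (sumset A B) g.
  apply/fsubsetP => x; rewrite inE => /orP[|].
    by rewrite inE => /eqP ->; rewrite in_col0 mem_sumset //= phiD phin addr0 mg.
  rewrite !in_col0 => /andP[xA ->]; rewrite andbT -[x]addr0.
  exact: mem_sumset.
have := fsubset_leq_card sub; rewrite cardfsU1.
by have -> : m + n \notin col phi [set 0] A g by apply/negP => /mmax; lia.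
Qed.

Lemma card_gain A : (#|` A| + #|sums (image phi A) C| <= #|` sumset A B|)%N.
Proof.
have := sum_cnt phi [set 0] A; rewrite cards1 mul1n => <-.
have := sum_cnt phi [set 0] (sumset A B); rewrite cards1 mul1n => <-.
rewrite -sum_mem -big_split; apply: leq_sum => g _ /=.
have [/column_gain|] := boolP (g \in sums _ _); first by rewrite addn1.
rewrite addn0 => gS; rewrite -/cnt0 cnt_notimage //; apply: contra gS.
by apply/subsetP/sub_sums/C0.
Qed.

Lemma card_image X : (#|image phi X| <= #|` X|)%N.
Proof.
have := sum_cnt phi [set 0] X; rewrite cards1 mul1n => <-.
by rewrite -sum_mem; apply: leq_sum => g _; case: (boolP (_ \in _)) => // /cnt_image.
Qed.

Lemma card_fiber_le H X g : (#|[set x in image phi X | (x - g)%R \in H]| <= cnt phi H X g)%N.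
Proof.
apply: leq_trans (card_image _); apply: subset_leq_card; apply/subsetP => _ /setIdP[/imageP[x xX ->] xg].
by apply: mem_image; rewrite in_col xX.
Qed.

Section Sub.
Variable H : {set G}.
Hypothesis H0 : 0 \in H.
Hypothesis HB : forall g k, g \in H -> k \in H -> g - k \in H.

Lemma peel_counts A T p : periodic H T ->
  (#|H| * #|` peel phi H A T p| = \sum_(g in T) (cnt phi H A g - p))%N /\
  (#|H| * #|` sumset (peel phi H A T p) B| <=
     \sum_(g in sums T C) (cnt phi H (sumset A B) g - p))%N.
Proof.
move=> pT; split.
  rewrite -(sum_cnt phi) [RHS]big_mkcond; apply: eq_bigr => g _; case: ifP => gT.
    by rewrite cnt_peel.
  by rewrite cnt_peel_out // gT.
rewrite -(sum_cnt phi) [leqRHS]big_mkcond; apply: leq_sum => g _.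
exact: cnt_peel_sumset.
Qed.

Lemma level_cnt A : level (cnt phi H A) 0 = sums (image phi A) H.
Proof.
apply/setP => g; rewrite mem_level; apply/cnt_gt0/sumsP => [[x xA xg]|[_ /imageP[x xA ->] xg]].
  by exists (phi x); rewrite ?mem_image // -opprB subgroupN.
by exists x => //; rewrite -opprB subgroupN.
Qed.

End Sub.

Lemma sum_cnt0_pred X : (\sum_g (cnt0 X g - 1) + #|image phi X| = #|` X|)%N.
Proof.
have := sum_cnt phi [set 0] X; rewrite cards1 mul1n => <-.
rewrite -sum_mem -big_split; apply: eq_bigr => g _ /=.
have [/cnt_image ?|/cnt_notimage] := boolP (_ \in _); first by rewrite subnK.
by rewrite /cnt0 => ->.
Qed.

Let D := (#|` B| - 2)%N.
Let exc A := (#|` sumset A B| - #|` A|)%N.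

Lemma card_C : #|C| = D.+1.
Proof. by have := B2; rewrite /D -cardC; lia. Qed.

Lemma leq_card_sumset A : (#|` A| <= #|` sumset A B|)%N.
Proof. exact: leq_trans (leq_addr _ _) (card_gain A). Qed.

Lemma periodic_sums_stab (X : {set G}) : periodic (stab (sums X C)) (sums X C).
Proof. by move=> g k gS /stabP ->. Qed.

Lemma attained_step a a1 E E1 m : (a = a1 + m)%N -> (m + D <= E)%N -> (E1 + D <= E)%N ->
  attained D a1 E1 -> attained D a E.
Proof.
move=> -> mE E1E [t Ht]; exists t.+1.
have : (2 * t * (E1 + D) <= 2 * t * E)%N by rewrite leq_mul2l E1E orbT.
by rewrite -[t.+2]addn2 -[t.+1]addn1; rewrite -[t.+1]addn1 in Ht; lia.
Qed.

Lemma attained_cyclic A : (#|G| <= exc A)%N \/ attained D #|` A| (exc A).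
Proof.
have [k] := ubnP #|` A|; elim: k A => // k IH A; rewrite ltnS => Ak.
have [|EG] := leqP #|G| (exc A); [by left|right].
have [->|A0] := eqVneq A fset0; first by rewrite cardfs0; apply: attained0.
set S := sums (image phi A) C; set a := #|` A|; set E := exc A in EG *.
have AE : #|` sumset A B| = (a + E)%N by rewrite /E /exc subnKC ?leq_card_sumset.
have SE : (#|S| <= E)%N by have := card_gain A; rewrite AE leq_add2l.
have SnT : S != setT by apply: contraTneq SE => ->; rewrite cardsT -ltnNge.
(* If the peeled set has excess at most [E < #|G|], the first alternative of the induction
   hypothesis is impossible for it. *)
have oracle H : 0 \in H -> (forall g g', g \in H -> g' \in H -> g - g' \in H) ->
    forall T p, periodic H T -> (\sum_(g in T) (cnt phi H A g - p) < #|H| * a)%N ->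
  exists a1 E1, [/\ (#|H| * a1 = \sum_(g in T) (cnt phi H A g - p))%N,
    (#|H| * (a1 + E1) <= \sum_(g in sums T C) (cnt phi H (sumset A B) g - p))%N
    & ((E1 <= E)%N -> attained D a1 E1)].
  move=> H0 HB T p pT lt; have [P1 P2] := peel_counts H0 HB A p pT.
  set A1 := peel _ _ _ _ _ in P1 P2.
  exists #|` A1|, (exc A1); split=> //.
    by rewrite /exc subnKC ?leq_card_sumset.
  move=> E1E; have [|/leq_trans/(_ E1E)|//] := IH A1.
    by move: lt; rewrite -P1 ltn_mul2l => /andP[_ ?]; apply: leq_trans Ak.
  by rewrite leqNgt EG.
have sA := sum_cnt0_pred A; rewrite -/a in sA.
have im0 : (0 < #|image phi A|)%N.
  have [x xA] := fset0Pn _ A0; apply/card_gt0P; exists (phi x); exact: mem_image.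
have [good|bad] := leqP (#|image phi A| + D) #|S|.
  have [||||a1 [E1 [Ha HE Hat]]] := oracle [set 0] _ _ setT 1%N.
  - by rewrite inE.
  - by move=> g g1; rewrite !inE => /eqP -> /eqP ->; rewrite subr0.
  - by move=> *; rewrite inE.
  - by rewrite cards1 mul1n sum_setT -/cnt0 -sA -[ltnLHS]addn0 ltn_add2l.
  rewrite cards1 !mul1n -/cnt0 in Ha HE.
  have {}HE : (a1 + E1 <= \sum_g (cnt0 (sumset A B) g - 1))%N.
    by apply: leq_trans HE _; rewrite [leqLHS]big_mkcond; apply: leq_sum => g _; case: ifP.
  rewrite sum_setT in Ha; have := sum_cnt0_pred (sumset A B).
  rewrite (image_sumset phiD) -/C -/S AE => sS.
  have E1E : (E1 + D <= E)%N.
    rewrite -Ha in sA; move: sA sS HE good; clear.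
    by move: #|image phi A| #|S| (\sum_(g : G) _)%N => *; lia.
  apply: (@attained_step _ a1 _ E1 #|image phi A|) => //.
  - by rewrite Ha sA.
  - exact: leq_trans good SE.
  - by apply: Hat; apply: leq_trans E1E; apply: leq_addr.
(* Kneser's theorem is applied to [K] and [C + H], whose sum is still [S]. All three sets are
   [H]-periodic, so their sizes are [l], [c] and [s] times [#|H|], with [c <= s - l + 1]. *)
pose K := closure C (image phi A); pose H := stab S.
have SK : sums K C = S by apply: sums_closure.
have H0 : 0 \in H by apply: stab0.
have HB g g1 : g \in H -> g1 \in H -> g - g1 \in H by apply: stabB.
have pS : periodic H S by apply: periodic_sums_stab.
have pK : periodic H K.
  by move=> g h /closureP gK hH; apply/closureP => c /gK gc; rewrite addrAC; apply: pS.
pose CH := sums C H.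
have pCH : periodic H CH.
  move=> g h /sumsP[c cC gc] hH; apply/sumsP; exists c => //.
  by rewrite addrAC; apply: subgroupD.
have KCH : sums K CH = S.
  apply/setP => g; apply/imset2P/idP => [[x _ xK /imset2P[c h cC hH ->] ->]|].
    by rewrite addrA; apply: pS; rewrite // -SK mem_sums.
  rewrite -SK => /imset2P[x c xK cC ->]; exists x c => //.
  by rewrite -[c]addr0 mem_sums.
have [x0 x0A] := fset0Pn _ A0.
have x0K : phi x0 \in K by apply: (subsetP (sub_closure _ _)); apply: mem_image.
have C_CH : C \subset CH by apply/subsetP => c cC; rewrite -[c]addr0 mem_sums.
have kn : (#|K| + #|CH| <= #|S| + #|H|)%N.
  have := @kneser _ K CH; rewrite KCH; apply.
    by apply/set0Pn; exists (phi x0).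
  by apply/set0Pn; exists 0; apply: (subsetP C_CH); apply: C0.
have [l El] := card_periodic H0 HB pK.
have [s Es] := card_periodic H0 HB pS.
have [c Ec] := card_periodic H0 HB pCH.
have h0 : (0 < #|H|)%N by apply/card_gt0P; exists 0.
have KS : K \subset S by rewrite -SK; apply/sub_sums/C0.
have imK : image phi A \subset K by apply: sub_closure.
have ls : (l <= s)%N by rewrite -(leq_pmul2l h0) -El -Es subset_leq_card.
pose q := (s - l)%N.
have sq : s = (l + q)%N by rewrite /q subnKC.
have cq : (c <= q.+1)%N.
  by move: kn; rewrite El Ec Es -mulnDr -mulnSr leq_pmul2l // sq -addnS leq_add2l.
have qD : (#|H| * q < D)%N.
  rewrite -(ltn_add2l (#|H| * l)) -mulnDr -sq -Es; apply: leq_trans bad _.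
  by rewrite leq_add2r -El subset_leq_card.
have CHD : (D < #|CH|)%N.
  by apply: leq_trans (subset_leq_card C_CH); rewrite card_C.
have c_q : c = q.+1.
  (* The lower bound comes from [#|H| * q < D < #|CH|]. *)
  apply/eqP; rewrite eqn_leq cq -(ltn_pmul2l h0) -Ec.
  exact: ltn_trans CHD.
pose e := (D - q * #|H|)%N.
have De : D = (q * #|H| + e)%N by rewrite /e subnKC // mulnC ltnW.
have e0h : (0 < e < #|H|)%N.
  rewrite subn_gt0 mulnC qD /=.
  by move: CHD; rewrite Ec c_q mulnSr {1}De [(q * _)%N]mulnC ltn_add2l.
have imA : (#|H| * l < #|image phi A| + e)%N.
  by move: bad; rewrite Es sq De mulnDr [(q * _)%N]mulnC addnC addnCA ltn_add2l.
pose L := sums (image phi A) H.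
have pL : periodic H L.
  move=> g k' /sumsP[x xA gx] hH; apply/sumsP; exists x => //.
  by rewrite addrAC; apply: subgroupD.
have LK : L = K.
  apply/eqP; rewrite eqEcard; apply/andP; split.
    by apply/subsetP => _ /imset2P[x k' xA hH ->]; apply: pK => //; apply: (subsetP imK).
  have [l' El'] := card_periodic H0 HB pL.
  rewrite El El' leq_pmul2l // -ltnS -(ltn_pmul2l h0) mulnSr -El'.
  apply: leq_trans imA _; apply: leq_add; last by case/andP: e0h => _ /ltnW.
  by apply: subset_leq_card; apply/subsetP => x xA; rewrite -[x]addr0 mem_sums.
have lev : level (cnt phi H A) 0 = K by rewrite level_cnt.
rewrite De.
apply: (@stage_attained G C H (cnt phi H A) (cnt phi H (sumset A B)) l q e a E) => //.
- exact: C0.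
- exact: cnt_hinv.
- by rewrite lev El mulnC.
- by rewrite lev SK Es sq mulnC.
- by rewrite lev /K /closure SK.
- by rewrite sum_cnt.
- by rewrite sum_cnt AE.
- move=> g; rewrite lev SK => gS; rewrite !cnt_cosets -sum1_card -big_split.
  apply: leq_sum => k' kH /=; rewrite addn1; apply: column_gain.
  exact: pS.
(* [C] misses [#|H| - e - 1] points of [CH], so at least [e + 1] elements of [B] lie over the coset
   of [c']; [card_sumset_ge] then gives a gain of [e]. *)
- move=> x c' ax c'C.
  have c'CH : c' \in CH by apply: (subsetP C_CH).
  have Hc := holes C_CH pCH c'CH.
  have cc : (e < cnt phi H B c')%N.
    apply: leq_trans (card_fiber_le H B c'); rewrite -(leq_add2l (#|H| * q.+1)) -c_q -Ec.
    apply: leq_trans Hc; rewrite Ec c_q mulnSr -addnA addnCA leq_add2l.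
    by rewrite card_C De addnS mulnC.
  have colc : sumset (col phi H A x) (col phi H B c') `<=` col phi H (sumset A B) (x + c').
    apply/fsubsetP => _ /sumsetP[y [b [+ + ->]]]; rewrite !in_col => /andP[yA yx] /andP[bB bc].
    by rewrite mem_sumset //= phiD opprD addrACA; apply: subgroupD.
  have := fsubset_leq_card colc; have := @card_sumset_ge (col phi H A x) (col phi H B c').
  rewrite -!cardfs_gt0 => /(_ ax (leq_ltn_trans (leq0n _) cc)).
  rewrite -!/(cnt _ _ _ _); move: cc; move: #|` sumset _ _| (cnt _ _ _ _) (cnt _ _ _ _) (cnt _ _ _ _); clear; lia.
(* The image of [A] misses fewer than [e] points of [K], hence fewer than [e] in any single
   coset. *)
- move=> x; rewrite -mem_level lev => xK.
  have Hx := holes imK pK xK; rewrite El in Hx.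
  have := card_fiber_le H A x; move: Hx imA e0h; clear.
  move: (#|H| * l)%N #|H| #|image phi A| #|[set _ in _ | _]| (cnt _ _ _ _) => *; lia.
- by rewrite lev SK.
- by move=> T p pT; rewrite sum_cnt -De; apply: oracle.
Qed.
End Cyclic.

(** * From the cyclic quotient to arbitrary [B]: gcd of differences, dilation and residue classes *)

Lemma sub_stab (G : finZmodType) (T : {set G}) g :
  (forall t, t \in T -> t + g \in T) -> g \in stab T.
Proof.
move=> Tg; apply/stabP => x.
have sub : [set t + g | t in T] \subset T by apply/subsetP => _ /imsetP[t /Tg ? ->].
have eqT : [set t + g | t in T] = T.
  by apply/eqP; rewrite eqEcard sub (card_imset _ (@addIr _ _)) leqnn.
by rewrite -{1}eqT (mem_imset _ _ (@addIr _ _)).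
Qed.

Lemma foldr_gcdz_dvd (s : seq int) x : x \in s -> (foldr gcdz 0 s %| x)%Z.
Proof.
elim: s => // y s IH; rewrite inE => /predU1P[->|/IH H] /=; first exact: dvdz_gcdl.
exact: dvdz_trans (dvdz_gcdr _ _) H.
Qed.

(** By Bezout's identity the gcd lies in every subgroup containing the list. *)
Lemma foldr_gcdz_ind (P : int -> Prop) (s : seq int) :
  P 0 -> (forall x y, P x -> P y -> P (x - y)) -> (forall x, x \in s -> P x) ->
  P (foldr gcdz 0 s).
Proof.
move=> P0 PB; elim: s => // y s IH Ps /=.
have PN x : P x -> P (- x) by move=> Px; rewrite -sub0r; apply: PB.
have PD x z : P x -> P z -> P (x + z) by move=> Px Pz; rewrite -[z]opprK; apply/PB/PN.
have PM x (k : int) : P x -> P (k * x).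
  move=> Px; have Pn (i : nat) : P (i%:Z * x).
    by elim: i => [|i IHi]; rewrite ?mul0r // intS mulrDl mul1r; apply: PD.
  by case: k => i //; rewrite NegzE mulNr; apply: PN.
have [u [v <-]] := Bezoutz y (foldr gcdz 0 s).
apply: PD; apply: PM; first by apply: Ps; rewrite mem_head.
by apply: IH => x xs; apply: Ps; rewrite inE xs orbT.
Qed.

(** The larger of the two values of [t] serves for both: raising it only increases the right-hand
    side of the other inequality, whose [D] term is dropped. *)
Lemma attained_add D a E a' E' : attained D a E -> attained D a' E' ->
  attained D (a + a') (E + E').
Proof.
move=> [t Ht] [t' Ht'].
have aux (x y u v X Y : nat) : (x <= y)%N -> (2 * u + x * x.+1 * D <= 2 * x * X)%N ->
    (2 * v + y * y.+1 * D <= 2 * y * Y)%N -> attained D (u + v) (X + Y).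
  move=> xy Hx Hy; exists y.
  have : (2 * x * X <= 2 * y * X)%N by rewrite leq_mul2r leq_mul2l xy !orbT.
  by lia.
have [tt|/ltnW tt] := leqP t t'; first exact: aux tt Ht Ht'.
by rewrite addnC [(E + _)%N]addnC; apply: aux tt Ht' Ht.
Qed.

(* The hypothesis on [P] says that the elements of [B] have gcd 1. *)
Lemma attained_primitive (B : {fset int}) (k : nat) :
  0 \in B -> (k.+2)%:Z \in B -> (forall b, b \in B -> 0 <= b <= (k.+2)%:Z) ->
  (forall P : int -> Prop, P 0 -> (forall x y, P x -> P y -> P (x - y)) ->
     (forall x, x \in B -> P x) -> P 1) ->
  forall A : {fset int},
    (k.+2 <= #|` sumset A B| - #|` A|)%N \/
    attained (#|` B| - 2) #|` A| (#|` sumset A B| - #|` A|).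
Proof.
move=> B0 Bn Bb prim A.
pose phi (z : int) : 'Z_(k.+2) := z%:~R.
have phiD : {morph phi : x y / x + y} by move=> x y; rewrite /phi intrD.
have phin : phi (k.+2)%:Z = 0 by rewrite /phi -pmulrn; apply: (@pchar_Zp k.+2).
have phiE (x : nat) : (x < k.+2)%N -> val (phi x) = x.
  by move=> xk; rewrite /phi -pmulrn; apply: etrans (@val_Zp_nat k.+2 isT x) (modn_small xk).
have phiI (X : {fset int}) : (forall x, x \in X -> 0 <= x < (k.+2)%:Z) ->
    #|` [fset phi x | x in X]| = #|` X|.
  move=> Xk; rewrite card_in_imfset //= => x y /Xk xk /Xk yk.
  case: x xk => // x; case: y yk => // y yk xk xy.
  by rewrite -(phiE x) ?xy ?phiE //; lia.
have cB : #|image phi B|.+1 = #|` B|.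
  rewrite (cardfsD1 (k.+2)%:Z) Bn add1n -phiI => [|x]; last first.
    by rewrite !inE => /andP[xk /Bb]; lia.
  congr _.+1.
  rewrite /= -(card_uniqP (fset_uniq _)); apply: eq_card => g.
  apply/imageP/imfsetP => [[b bB ->]|[b /=]]; last first.
    by rewrite !inE => /andP[_ bB] ->; exists b.
  have [->|bk] := eqVneq b (k.+2)%:Z; last by exists b; rewrite //= !inE bk.
  by exists 0; rewrite ?phin ?(phi_0 phiD) //= !inE.
rewrite -[X in (X <= _)%N](card_ord k.+2).
apply: (@attained_cyclic 'Z_(k.+2) phi phiD B (k.+2)%:Z) => //.
  have : [fset 0; (k.+2)%:Z] `<=` B by apply/fsubsetP => x; rewrite !inE => /orP[]/eqP ->.
  by move/fsubset_leq_card; rewrite cardfs2.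
move=> T /set0Pn[t tT] TC.
(* The integers that [phi] sends into [stab T] form a subgroup containing [B], hence contain [1]. *)
have one : 1 \in stab T.
  have -> : 1 = phi 1 by [].
  apply: (prim (fun z => phi z \in stab T)).
  - by rewrite (phi_0 phiD) stab0.
  - by move=> x y; rewrite (phi_B phiD); apply: stabB.
  - move=> b bB; apply: sub_stab => x xT; apply: (subsetP TC); apply: mem_sums => //.
    exact: mem_image.
apply/setP => x; rewrite inE -[x](subrK t) addrC -[x - t]natr_Zp.
elim: (nat_of_ord (x - t)) => [|i IH]; first by rewrite addr0.
by rewrite -natr1 addrA; move/stabP: one => ->.
Qed.

Lemma leq_card_sumsetl (A B : {fset int}) : B != fset0 -> (#|` A| <= #|` sumset A B|)%N.
Proof.
move=> B0; have [->|A0] := eqVneq A fset0; first by rewrite cardfs0.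
have := card_sumset_ge A0 B0; move: B0; rewrite -cardfs_gt0; lia.
Qed.

Definition dilate (u g : int) (X : {fset int}) : {fset int} := [fset u + g * x | x in X].

Lemma card_dilate u g X : g != 0 -> #|` dilate u g X| = #|` X|.
Proof. by move=> g0; rewrite card_imfset //= => x y /addrI /(mulfI g0). Qed.

Lemma dilateP u g X z : reflect (exists2 x, x \in X & z = u + g * x) (z \in dilate u g X).
Proof.
apply: (iffP idP) => [/imfsetP[x /= xX ->]|[x xX ->]]; first by exists x.
by apply/imfsetP; exists x.
Qed.

Lemma sumset_dilate u v g X Y :
  sumset (dilate u g X) (dilate v g Y) = dilate (u + v) g (sumset X Y).
Proof.
apply/fsetP => z; apply/sumsetP/dilateP.
  case=> _ [_ [/dilateP[x xX ->] /dilateP[y yY ->] ->]].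
  by exists (x + y); rewrite ?mem_sumset // mulrDr addrACA.
case=> _ /sumsetP[x [y [xX yY ->]]] ->; exists (u + g * x), (v + g * y).
by split; [apply/dilateP; exists x|apply/dilateP; exists y|rewrite mulrDr addrACA].
Qed.

Lemma dilate_of_dvd u g X : g != 0 -> (forall x, x \in X -> (g %| x - u)%Z) ->
  exists X', X = dilate u g X'.
Proof.
move=> g0 Xg; exists [fset ((x - u) %/ g)%Z | x in X].
have E x : x \in X -> x = u + g * ((x - u) %/ g)%Z.
  by move=> /Xg/divzK; rewrite mulrC => ->; rewrite addrC subrK.
apply/fsetP => z; apply/idP/dilateP => [zX|[_ /imfsetP[x /= xX ->] ->]]; last by rewrite -E.
by exists ((z - u) %/ g)%Z; [apply/imfsetP; exists z|apply: E].
Qed.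

Lemma attained_or_progression (B : {fset int}) : (2 < #|` B|)%N ->
  exists (m g : int) (n : nat), [/\ 0 < g,
    forall b, b \in B -> exists2 i : nat, (i <= n)%N & b = m + g * i%:Z &
    forall A : {fset int}, (n <= #|` sumset A B| - #|` A|)%N \/
      attained (#|` B| - 2) #|` A| (#|` sumset A B| - #|` A|)].
Proof.
move=> B3; have B0 : B != fset0 by rewrite -cardfs_gt0; lia.
have [m mB mmin] := fset_min B0; have [M MB Mmax] := fset_max B0.
pose s := [seq b - m | b <- B]; pose g := foldr gcdz 0 s.
have gdvd b : b \in B -> (g %| b - m)%Z.
  by move=> bB; apply: foldr_gcdz_dvd; apply: map_f.
have mM : m < M.
  rewrite lt_neqAle mmin // andbT; apply: contraTneq B3 => mM; rewrite -leqNgt.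
  have : B `<=` [fset m].
    by apply/fsubsetP => b bB; rewrite inE eq_le mmin // andbT mM Mmax.
  by move/fsubset_leq_card; rewrite cardfs1; lia.
have g0 : 0 < g.
  have gge : 0 <= g by rewrite /g; case: (s) => //= y t; apply: gcdz_ge0.
  rewrite lt_neqAle gge andbT eq_sym; apply: contraTneq (gdvd _ MB) => ->.
  by rewrite dvd0z subr_eq0 gt_eqF.
have gn0 : g != 0 by rewrite gt_eqF.
have [B' BE] := dilate_of_dvd gn0 gdvd.
have inB' x : x \in B' -> m + g * x \in B by move=> xB; rewrite BE; apply/dilateP; exists x.
have B'0 : 0 \in B'.
  move: mB; rewrite BE => /dilateP[x xB /eqP]; rewrite -subr_eq0 opprD addrA subrr sub0r oppr_eq0.
  by rewrite mulf_eq0 (negbTE gn0) => /eqP <-.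
have [N NB ME] : exists2 N, N \in B' & M = m + g * N by apply/dilateP; rewrite -BE.
have B'b b : b \in B' -> 0 <= b <= N.
  move=> /inB' bB; have := mmin _ bB; have := Mmax _ bB.
  by rewrite ME lerD2l ler_pM2l // lerDl pmulr_rge0 // => -> ->.
have cB : #|` B| = #|` B'| by rewrite BE card_dilate.
have N2 : 2%:Z <= N.
  rewrite leNgt; apply: contraTN B3 => N2; rewrite cB -leqNgt.
  have : B' `<=` [fset 0; 1] by apply/fsubsetP => b /B'b; rewrite !inE; lia.
  by move/fsubset_leq_card; rewrite cardfs2.
have [k kE] : exists k : nat, N = (k.+2)%:Z by exists (`|N| - 2)%N; lia.
subst N; have prim (P : int -> Prop) : P 0 -> (forall x y, P x -> P y -> P (x - y)) ->
    (forall x, x \in B' -> P x) -> P 1.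
  move=> P0 PB Px.
  have [|||u ug Pu] := @foldr_gcdz_ind (fun z => exists2 u, z = g * u & P u) s.
  - by exists 0; rewrite ?mulr0.
  - by move=> _ _ [x -> Pxx] [y -> Py]; exists (x - y); rewrite ?mulrBr //; apply: PB.
  - move=> _ /mapP[b bB ->]; move: bB; rewrite BE => /dilateP[x xB ->].
    by exists x; [rewrite addrC addKr|apply: Px].
  suff -> : 1 = u by [].
  by apply: (mulfI gn0); rewrite mulr1 -ug.
have cyc := attained_primitive B'0 NB B'b prim.
exists m, g, k.+2; split=> //.
  move=> b; rewrite BE => /dilateP[x xB ->]; have /andP[x0 xk] := B'b _ xB.
  by exists `|x|%N; lia.
move=> A; have [j] := ubnP #|` A|; elim: j A => // j IH A; rewrite ltnS => Aj.
have [->|/fset0Pn[a0 a0A]] := eqVneq A fset0.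
  by right; rewrite cardfs0; apply: attained0.
(* One residue class modulo [g] is split off. All of [B] is congruent to [m], so the two partial
   sumsets are disjoint and the excesses add. The class [A0] is a dilate, to which [cyc] applies;
   [A1] falls under the induction hypothesis. *)
pose A0 := [fset a in A | (g %| a - a0)%Z]; pose A1 := A `\` A0.
have a0A0 : a0 \in A0 by rewrite !inE a0A subrr dvdz0.
have AU : A0 `|` A1 = A.
  by apply/fsetP => a; rewrite !inE; case: (a \in A) => //=; case: (_ %| _)%Z.
have dA : [disjoint A0 & A1]%fset by apply/fdisjointP => a aA; rewrite inE aA.
have cA : #|` A| = (#|` A0| + #|` A1|)%N.
  by rewrite -AU cardfsU; move: dA; rewrite -fsetI_eq0 => /eqP ->; rewrite cardfs0 subn0.
have A1A : (#|` A1| < #|` A|)%N.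
  by rewrite cA -[ltnLHS]add0n ltn_add2r cardfs_gt0; apply/fset0Pn; exists a0.
have SU : sumset A0 B `|` sumset A1 B = sumset A B.
  apply/fsetP => z; rewrite inE; apply/orP/sumsetP => [[]/sumsetP[a [b [aA bB ->]]]|].
  - by exists a, b; rewrite -AU inE aA.
  - by exists a, b; rewrite -AU inE aA orbT.
  by case=> a [b [+ bB ->]]; rewrite -AU inE => /orP[aA|aA]; [left|right]; apply: mem_sumset.
have dS : [disjoint sumset A0 B & sumset A1 B]%fset.
  apply/fdisjointP => _ /sumsetP[a [b [aA bB ->]]]; apply/negP => /sumsetP[a' [b' [aA' bB' E]]].
  have : a' \in A0.
    move: aA aA'; rewrite !inE => /andP[_ ga] /andP[_ ->] /=.
    have -> : a' - a0 = (a - a0) + ((b - m) - (b' - m)) by rewrite opprB; move: E; clear; lia.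
    by apply: rpredD => //; apply: rpredB; apply: gdvd.
  by move: aA'; rewrite inE => /andP[/negP].
have cS : #|` sumset A B| = (#|` sumset A0 B| + #|` sumset A1 B|)%N.
  by rewrite -SU cardfsU; move: dS; rewrite -fsetI_eq0 => /eqP ->; rewrite cardfs0 subn0.
have := leq_card_sumsetl A0 B0; have := leq_card_sumsetl A1 B0; rewrite cS cA => l1 l0.
have -> : (#|` sumset A0 B| + #|` sumset A1 B| - (#|` A0| + #|` A1|) =
  (#|` sumset A0 B| - #|` A0|) + (#|` sumset A1 B| - #|` A1|))%N.
  by move: l0 l1; clear; lia.
have [|A1n|A1at] := IH A1; first exact: leq_trans A1A Aj.
  by left; apply: leq_trans A1n (leq_addl _ _).
have [|A' A'E] := @dilate_of_dvd a0 g A0 gn0; first by move=> a; rewrite !inE => /andP[].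
have := cyc A'; rewrite -cB -(card_dilate a0 A' gn0) -(card_dilate (a0 + m) (sumset A' B') gn0).
rewrite -sumset_dilate -A'E -BE => -[A0n|A0at]; [left|right].
  exact: leq_trans A0n (leq_addr _ _).
exact: attained_add.
Qed.

(** * The hypotheses of the theorem exclude [attained] *)

Lemma not_attained (D a E s : nat) :
  (0 < s)%N -> ((s - 1) * s * D + 2 * (s - 1) < 2 * a)%N ->
  (2 * a <= s * s.+1 * D + 2 * s)%N ->
  (2 * s * E < 2 * a + s * s.+1 * D)%N -> ~ attained D a E.
Proof.
move=> s0 lo hi lt [t Ht].
have [ts|st|ts] := ltngtP t s; last by subst t; lia.
- have [d sE] : exists d, s = (t + d.+1)%N by exists (s - t).-1; lia.
  (* Success at [t] and failure at [s] are subtracted and divided by [s - t]. The resulting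
     [E < s * D] makes [a] too small for its lower bound. *)
  have E2 : (2 * E < (s + t).+1 * D)%N.
    rewrite -(@ltn_pmul2l d.+1) //; move: lt Ht; rewrite sE; clear; lia.
  have E1 : (E < s * D)%N.
    have : ((s + t).+1 * D <= 2 * s * D)%N by rewrite leq_mul2r; lia.
    by move: E2; clear; lia.
  have E3 : (2 * t * E <= 2 * t * (s * D))%N by rewrite leq_mul2l (ltnW E1) orbT.
  have E4 : (0 <= d * d.+1 * D)%N by [].
  move: lo E3 Ht E4; rewrite sE addnS subn1 /=; clear; lia.
- have [d tE] : exists d, t = (s + d.+1)%N by exists (t - s).-1; lia.
  (* Symmetrically, [E] is now at least [(s + 1) * D + 1]; with the upper bound on [a] this
     contradicts the failure at [s]. *)
  have E2 : ((s + t).+1 * D < 2 * E)%N.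
    rewrite -(@ltn_pmul2l d.+1) //; move: lt Ht; rewrite tE; clear; lia.
  have E1 : (s.+1 * D < E)%N.
    have : (2 * s.+1 * D <= (s + t).+1 * D)%N by rewrite leq_mul2r; lia.
    by move: E2; clear; lia.
  have E3 : (2 * s * (s.+1 * D).+1 <= 2 * s * E)%N by rewrite leq_mul2l E1 orbT.
  by move: E3 lt hi; clear; lia.
Qed.

Lemma rat_bounds (a b E s : nat) : (2 <= b)%N -> (0 < s)%N ->
  (s%:R - 1) * s%:R * (b%:R / 2 - 1) + s%:R - 1 < a%:R :> rat ->
  a%:R <= s%:R * (s%:R + 1) * (b%:R / 2 - 1) + s%:R :> rat ->
  (a + E)%N%:R < (a%:R / s%:R + b%:R / 2 - 1) * (s%:R + 1) :> rat ->
  ~ attained (b - 2) a E.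
Proof.
move=> b2 s0; have [D ->] : exists D, b = (D + 2)%N by exists (b - 2)%N; lia.
rewrite addnK => lo hi lt; apply: (@not_attained _ _ _ s) => //.
- rewrite -(ltr_nat rat) !(natrD, natrM) natrB // mulr1n.
  by move: lo; rewrite natrD; lra.
- by rewrite -(ler_nat rat) !(natrD, natrM) -natr1; move: hi; rewrite natrD; lra.
- have sR : 0 < s%:R :> rat by rewrite ltr0n.
  rewrite -(ltr_nat rat) !(natrD, natrM) -natr1.
  move: lt; rewrite -(ltr_pM2l sR) !natrD.
  have -> : s%:R * ((a%:R / s%:R + (D%:R + 2) / 2 - 1) * (s%:R + 1)) =
    a%:R * (s%:R + 1) + s%:R * (s%:R + 1) * D%:R / 2 :> rat by field; rewrite gt_eqF.
  lra.
Qed.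

Theorem theorem1p1 (A B : {fset int}) (s : nat) (r : int)
  (hA : A != fset0) (hB : B != fset0) (hB3 : (3 <= #|` B|)%N)
  (hs : (1 <= s)%N)
  (hs_lo : (s%:R - 1) * s%:R * (#|` B|%:R / 2 - 1) + s%:R - 1
             < #|` A|%:R :> rat)
  (hs_hi : #|` A|%:R
             <= s%:R * (s%:R + 1) * (#|` B|%:R / 2 - 1) + s%:R :> rat)
  (hr : (#|` sumset A B|)%:Z = (#|` A|)%:Z + (#|` B|)%:Z + r)
  (hlt : #|` sumset A B|%:R
           < (#|` A|%:R / s%:R + #|` B|%:R / 2 - 1) * (s%:R + 1) :> rat) :
  exists P_B : {fset int},
    [/\ is_arith_prog P_B, B `<=` P_B
      & (#|` P_B|)%:Z <= (#|` B|)%:Z + r + 1].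
Proof.
have leS := leq_card_sumsetl A hB.
have [m [g [n [g0 BP main]]]] := attained_or_progression hB3.
have {main} nE : (n <= #|` sumset A B| - #|` A|)%N.
  case: (main A) => //; move: hlt; rewrite -{1}(subnKC leS) => hlt at_.
  by case: (rat_bounds (ltnW hB3) hs hs_lo hs_hi hlt at_).
pose P := [fset m + g *+ i | i in iota 0 n.+1]; exists P; split.
- by exists m, g, n.+1.
- apply/fsubsetP => _ /BP[i ik ->]; apply/imfsetP; exists i.
    by change (i \in iota 0 n.+1); rewrite mem_iota add0n ltnS.
  by rewrite -mulr_natr natz.
(* The [n + 1] terms suffice because [n <= #|A + B| - #|A| = #|B| + r]. *)
- have : (#|` P| <= n.+1)%N.
    apply: leq_trans (leq_imfset_card _ _ _) _; rewrite -[leqRHS](size_iota 0).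
    by apply: uniq_leq_size (enum_finmem_uniq _) _ => i; rewrite enum_finmemE.
  move: hr nE leS; move: #|` P| #|` sumset A B| #|` A| #|` B|; clear; lia.
Qed.
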